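(* Let $\mathrm{Diff}_+^1(\mathbb{S}^1)$ be the topological group of orientation-preserving $C^1$-diffeomorphisms of the circle $\mathbb{S}^1$, with the $C^1$ topology. Then there exists a finitely generated subgroup of $\mathrm{Diff}_+^1(\mathbb{S}^1)$ which is dense in $\mathrm{Diff}_+^1(\mathbb{S}^1)$.
   Context: The $C^1$ topology on $\mathrm{Diff}_+^1(\mathbb{S}^1)$ is the topology of uniform convergence of maps and of their first derivatives; the group operation is composition. *)

(* Defs.v *)
From HB Require Import structures.
From mathcomp Require Import all_boot all_order all_algebra.
From mathcomp Require Import ring lra.
From mathcomp Require Import all_classical all_reals all_analysis.

Set Implicit Arguments.
Unset Strict Implicit.
Unset Printing Implicit Defensive.

Import Order.TTheory GRing.Theory Num.Theory.
Import numFieldNormedType.Exports.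

Local Open Scope classical_set_scope.
Local Open Scope ring_scope.

(* As a type, [circle R] carries the uniform structure induced by [R * R]. *)
Definition circle (R : realType) : set (R * R) :=
  [set p | p.1 ^+ 2 + p.2 ^+ 2 = 1].
Arguments circle R : clear implicits.

Section CircleMaps.
Context {R : realType}.
Implicit Types (f g : circle R -> circle R) (s t : R).

Lemma cos_sin_circle t : (cos t, sin t) \in circle R.
Proof. by rewrite inE /circle /= cos2Dsin2. Qed.

Definition expi t : circle R := SigSub (cos_sin_circle t).

(* Since t |-> expi t is a smooth covering and the circle is an embedded
   submanifold of the plane, regularity of f is regularity of this curve. *)
Definition angle_curve f t : R * R := set_val (f (expi t)).

Definition is_C1 f : Prop :=
  (forall t, derivable (angle_curve f) t 1) /\
  continuous (derive1 (angle_curve f)).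

(* The first derivative of f at expi t: for any local lift, that is
   f (expi t) = expi (theta t), it is theta'(t) (the component of the velocity
   of the curve along the unit tangent vector (- sin, cos) at f (expi t)). *)
Definition angle_derivative f t : R :=
  let p := angle_curve f t in
  let v := derive1 (angle_curve f) t in
  p.1 * v.2 - p.2 * v.1.

Definition is_C1_diffeo f : Prop :=
  is_C1 f /\ exists g, [/\ cancel f g, cancel g f & is_C1 g].

Definition orientation_preserving f : Prop :=
  forall t, 0 < angle_derivative f t.

Lemma circle_eqP (p q : circle R) : set_val p = set_val q -> p = q.
Proof. exact: val_inj. Qed.

Lemma circleE (p : circle R) : (set_val p).1 ^+ 2 + (set_val p).2 ^+ 2 = 1.
Proof. by have := valP p; rewrite inE. Qed.

Lemma expi_surj (p : circle R) : exists t, expi t = p.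
Proof.
have := circleE p; set q := set_val p => pE.
have q1B : -1 <= q.1 <= 1 by apply/andP; split; nra.
have sE : sin (acos q.1) = `|q.2|.
  by rewrite sin_acos// (_ : 1 - _ = q.2 ^+ 2) ?sqrtr_sqr//; lra.
have [q20|q20] := leP 0 q.2.
  exists (acos q.1); apply/circle_eqP; rewrite -/q set_valE/=.
  by rewrite acosK ?in_itv//= sE ger0_norm//; case: (q).
exists (- acos q.1); apply/circle_eqP; rewrite -/q set_valE/=.
rewrite cosN sinN acosK ?in_itv//= sE ltr0_norm// opprK.
by case: (q).
Qed.

Lemma is_derive_cvgP (V : normedModType R) (c : R -> V) t (v : V) :
  is_derive t 1 c v <->
  h^-1 *: ((c \o shift t) (h *: 1) - c t) @[h --> 0^'] --> v.
Proof.
split=> [[d <-]//|h]; apply: DeriveDef; last exact: cvg_lim h.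
by apply/cvg_ex; exists v.
Qed.

Lemma cvg_fst1 T (F : set_system T) {FF : Filter F} (c : T -> R * R) (v : R * R) :
  c x @[x --> F] --> v -> (c x).1 @[x --> F] --> v.1.
Proof.
by move=> h; apply: (cvg_comp c fst h); case: v {h} => a b; exact: cvg_fst.
Qed.

Lemma cvg_snd1 T (F : set_system T) {FF : Filter F} (c : T -> R * R) (v : R * R) :
  c x @[x --> F] --> v -> (c x).2 @[x --> F] --> v.2.
Proof.
by move=> h; apply: (cvg_comp c snd h); case: v {h} => a b; exact: cvg_snd.
Qed.

Lemma is_derive_pairP (c : R -> R * R) t (v : R * R) :
  is_derive t 1 c v <->
  is_derive t 1 (fst \o c) v.1 /\ is_derive t 1 (snd \o c) v.2.
Proof.
split=> [/is_derive_cvgP h|[/is_derive_cvgP h1 /is_derive_cvgP h2]].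
  split; apply/is_derive_cvgP.
    exact: cvg_fst1 h.
  exact: cvg_snd1 h.
apply/is_derive_cvgP; case: v h1 h2 => a b /= h1 h2.
exact: (cvg_pair h1 h2).
Qed.

Lemma is_derive_comp1 (V : normedModType R) (h : R -> R) (c : R -> V) t a v :
  is_derive t 1 h a -> is_derive (h t) 1 c v -> is_derive t 1 (c \o h) (a *: v).
Proof.
move=> [dh eh] [dc ec].
have Dh : differentiable h t by apply/derivable1_diffP.
have Dc : differentiable c (h t) by apply/derivable1_diffP.
have Dch : differentiable (c \o h) t by apply: differentiable_comp.
apply: DeriveDef; first exact/derivable1_diffP.
have eh' : 'd h t 1 = a by rewrite -deriveE.
have ec' : 'd c (h t) 1 = v by rewrite -deriveE.
rewrite deriveE// diff_comp//= eh' -[X in 'd _ _ X = _]mulr1.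
by rewrite [LHS]linearZ ec'.
Qed.

Lemma derivable_is_derive (V : normedModType R) (c : R -> V) t :
  derivable c t 1 -> is_derive t 1 c (derive1 c t).
Proof. by move=> d; apply: DeriveDef => //; rewrite derive1E. Qed.

Lemma is_derive_derive1 (V : normedModType R) (c : R -> V) t v :
  is_derive t 1 c v -> derive1 c t = v.
Proof. by move=> [_ <-]; rewrite derive1E. Qed.

Lemma derivable_cvg (V : normedModType R) (c : R -> V) t :
  derivable c t 1 -> {for t, continuous c}.
Proof. by move=> /derivable1_diffP/differentiable_continuous. Qed.

Lemma local_lift f t0 s0 :
  derivable (angle_curve f) t0 1 -> expi s0 = f (expi t0) ->
  exists theta : R -> R, [/\ theta t0 = s0,
    is_derive t0 1 theta (angle_derivative f t0) &
    \forall t \near t0, expi (theta t) = f (expi t)].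
Proof.
move=> df s0E; rewrite /angle_derivative.
have pE : angle_curve f t0 = (cos s0, sin s0) by rewrite /angle_curve -s0E.
have cE t : (angle_curve f t).1 ^+ 2 + (angle_curve f t).2 ^+ 2 = 1.
  exact: circleE.
have cc : angle_curve f t @[t --> t0] --> (cos s0, sin s0).
  by rewrite -pE; exact: derivable_cvg df.
rewrite pE/=.
have /is_derive_pairP[d1 d2] := derivable_is_derive df.
set v := derive1 _ t0 in d1 d2 *.
pose u : R -> R := cos s0 *: (snd \o angle_curve f)
                   - sin s0 *: (fst \o angle_curve f).
have du : is_derive t0 1 u (cos s0 * v.2 - sin s0 * v.1).
  exact: is_deriveB.
have u0 : u t0 = 0 by rewrite /u /= !fctE /= pE /= /GRing.scale /=; ring.
exists (fun t => s0 + asin (u t)); split.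
- have pi0 : 0 <= pi / 2 :> R by rewrite divr_ge0// pi_ge0.
  by rewrite u0 -{1}sin0 sinK ?addr0// in_itv/= oppr_le0 pi0.
- have da : is_derive (u t0) 1 (@asin R) 1.
    have := @is_derive1_asin R (u t0); rewrite u0 expr0n subr0 sqrtr1 invr1.
    by apply; lra.
  have := is_derive_comp1 du da; rewrite scaler1.
  have -> : (fun t => s0 + asin (u t)) = cst s0 + (@asin R \o u) by [].
  by move=> dau; rewrite -[X in is_derive _ _ _ X]add0r; exact: is_deriveD.
- have : cos s0 * (angle_curve f t).1 + sin s0 * (angle_curve f t).2
      @[t --> t0] --> cos s0 * cos s0 + sin s0 * sin s0.
    apply: cvgD; (apply: cvgM; first exact: cvg_cst).
      exact: cvg_fst1 cc.
    exact: cvg_snd1 cc.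
  rewrite -!expr2 cos2Dsin2 => /cvgr_gt/(_ _ ltr01); apply: filterS => t.
  set x := (angle_curve f t).1; set y := (angle_curve f t).2 => dgt0.
  have uE : u t = cos s0 * y - sin s0 * x by [].
  have := cos2Dsin2 s0; have := cE t; rewrite -/x -/y => xy cs.
  have ud : 1 - u t ^+ 2 = (cos s0 * x + sin s0 * y) ^+ 2.
    by rewrite -[1](mulr1 1) -{1}cs -xy uE; ring.
  have uB : -1 <= u t <= 1.
    by have := sqr_ge0 (cos s0 * x + sin s0 * y); rewrite -ud => ?; nra.
  apply/circle_eqP; rewrite [RHS]surjective_pairing -/(angle_curve f t) -/x -/y.
  rewrite set_valE/= cosD sinD cos_asin// asinK ?in_itv//= ud.
  rewrite sqrtr_sqr gtr0_norm// uE.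
  by congr (_, _); rewrite -[RHS]mul1r -cs; ring.
Qed.

Lemma angle_derivative_continuous f : is_C1 f -> continuous (angle_derivative f).
Proof.
move=> [df cf] t; have cc := derivable_cvg (df t).
apply: cvgB; apply: cvgM.
- exact: cvg_fst1.
- exact: cvg_snd1 (cf t).
- exact: cvg_snd1.
- exact: cvg_fst1 (cf t).
Qed.

Lemma angle_curve_comp f g t s :
  derivable (angle_curve f) t 1 -> derivable (angle_curve g) s 1 ->
  expi s = f (expi t) ->
  is_derive t 1 (angle_curve (g \o f))
    (angle_derivative f t *: derive1 (angle_curve g) s).
Proof.
move=> df dg sE; have [h [ht dh nh]] := local_lift df sE.
have := derivable_is_derive dg; rewrite -ht => dg'.
apply: near_eq_is_derive (is_derive_comp1 dh dg').
by apply: filterS nh => x hx; rewrite /angle_curve/= hx.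
Qed.

Lemma angle_derivative_comp f g t s : is_C1 f -> is_C1 g ->
  expi s = f (expi t) ->
  angle_derivative (g \o f) t = angle_derivative g s * angle_derivative f t.
Proof.
move=> [df _] [dg _] sE.
have e := is_derive_derive1 (angle_curve_comp (df t) (dg s) sE).
rewrite [LHS]/angle_derivative e [X in _ = X * _]/angle_derivative.
have -> : angle_curve (g \o f) t = angle_curve g s by rewrite /angle_curve sE.
by move=> /=; rewrite /GRing.scale/=; ring.
Qed.

Lemma is_C1_comp f g : is_C1 f -> is_C1 g -> is_C1 (g \o f).
Proof.
move=> Cf Cg; have [df cf] := Cf; have [dg cg] := Cg; split=> t.
  have [s sE] := expi_surj (f (expi t)).
  by have [] := angle_curve_comp (df t) (dg s) sE.
have [s sE] := expi_surj (f (expi t)).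
have [h [ht dh nh]] := local_lift (df t) sE.
have hc : {for t, continuous h} by apply: derivable_cvg; case: dh.
have E x : expi (h x) = f (expi x) -> derive1 (angle_curve (g \o f)) x =
    angle_derivative f x *: derive1 (angle_curve g) (h x).
  by move=> hx; exact: is_derive_derive1 (angle_curve_comp (df x) (dg _) hx).
rewrite /continuous_at E; last exact: nbhs_singleton nh.
have : angle_derivative f x *: derive1 (angle_curve g) (h x) @[x --> t] -->
    angle_derivative f t *: derive1 (angle_curve g) (h t).
  apply: cvgZ; first exact: angle_derivative_continuous.
  by apply: continuous_comp; [exact: hc | exact: cg].
apply: cvg_trans; apply: near_eq_cvg.
by apply: filterS nh => x /E ->.
Qed.

Lemma is_derive_angle_curve_id t :
  is_derive t 1 (angle_curve id) (- sin t, cos t).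
Proof. by apply/is_derive_pairP; split; [exact: is_derive_cos|exact: is_derive_sin]. Qed.

Lemma angle_derivative_id t : angle_derivative id t = 1.
Proof.
rewrite /angle_derivative (is_derive_derive1 (is_derive_angle_curve_id t)).
by rewrite /angle_curve set_valE/= mulrN opprK -!expr2 cos2Dsin2.
Qed.

Lemma is_C1_id : is_C1 id.
Proof.
split=> t; first by have [] := is_derive_angle_curve_id t.
have -> : derive1 (angle_curve id) = fun t => (- sin t, cos t).
  by apply/funext => x; exact: is_derive_derive1 (is_derive_angle_curve_id x).
have s : - sin x @[x --> t] --> - sin t by apply: cvgN; exact: continuous_sin.
have c : cos x @[x --> t] --> cos t by exact: continuous_cos.
exact: (cvg_pair s c).
Qed.

Lemma orientation_preserving_cancel f g : is_C1 f -> is_C1 g ->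
  cancel f g -> cancel g f -> orientation_preserving f ->
  orientation_preserving g.
Proof.
move=> Cf Cg fK gK f_gt0 s; have [t tE] := expi_surj (g (expi s)).
have := angle_derivative_comp Cg Cf tE.
have -> : f \o g = id by apply/funext => x; exact: gK.
rewrite angle_derivative_id => e; have := f_gt0 t => ft.
by rewrite -(pmulr_rgt0 _ ft) -e.
Qed.
End CircleMaps.

Section Diff1p.
Variable R : realType.

Record diff1p := Diff1p {
  diff1p_fun :> circle R -> circle R;
  diff1p_C1 : is_C1_diffeo diff1p_fun;
  diff1p_pos : orientation_preserving diff1p_fun }.

HB.instance Definition _ := gen_eqMixin diff1p.
HB.instance Definition _ := gen_choiceMixin diff1p.

Implicit Types f g : diff1p.

Lemma diff1p_eqP f g : f =1 g -> f = g.
Proof.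
case: f g => f fC fp [g gC gp] /= /funext fg; case: _ / fg in gC gp *.
by congr Diff1p; exact: Prop_irrelevance.
Qed.

Definition diff1p_id : diff1p.
Proof.
exists id; last by move=> t; rewrite angle_derivative_id.
by split; [exact: is_C1_id | exists id; split=> //; exact: is_C1_id].
Defined.

Definition diff1p_comp f g : diff1p.
Proof.
exists (f \o g).
  have [fC [f' [fK f'K f'C]]] := diff1p_C1 f.
  have [gC [g' [gK g'K g'C]]] := diff1p_C1 g.
  split; first exact: is_C1_comp.
  by exists (g' \o f'); split; [exact: can_comp|exact: can_comp|exact: is_C1_comp].
have [fC _] := diff1p_C1 f; have [gC _] := diff1p_C1 g.
move=> t; have [s sE] := expi_surj (g (expi t)).
by rewrite (angle_derivative_comp gC fC sE) mulr_gt0// diff1p_pos.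
Defined.

Lemma diff1p_inv_subproof f : exists g : diff1p, cancel f g /\ cancel g f.
Proof.
have [fC [g [fK gK gC]]] := diff1p_C1 f.
have gP : is_C1_diffeo g by split=> //; exists f.
have fp := @diff1p_pos f.
by exists (Diff1p gP (orientation_preserving_cancel fC gC fK gK fp)).
Qed.

Definition diff1p_inv f : diff1p := projT1 (cid (diff1p_inv_subproof f)).

Lemma diff1p_funK f : cancel f (diff1p_inv f).
Proof. by rewrite /diff1p_inv; case: cid => g []. Qed.

Lemma diff1p_invK f : cancel (diff1p_inv f) f.
Proof. by rewrite /diff1p_inv; case: cid => g []. Qed.

Lemma diff1p_compA : associative diff1p_comp.
Proof. by move=> f g h; exact: diff1p_eqP. Qed.

Lemma diff1p_id_comp : left_id diff1p_id diff1p_comp.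
Proof. by move=> f; exact: diff1p_eqP. Qed.

Lemma diff1p_comp_id : right_id diff1p_id diff1p_comp.
Proof. by move=> f; exact: diff1p_eqP. Qed.

Lemma diff1p_comp_invl : left_inverse diff1p_id diff1p_inv diff1p_comp.
Proof. by move=> f; apply: diff1p_eqP => x; exact: diff1p_funK. Qed.

Lemma diff1p_comp_invr : right_inverse diff1p_id diff1p_inv diff1p_comp.
Proof. by move=> f; apply: diff1p_eqP => x; exact: diff1p_invK. Qed.

HB.instance Definition _ := isGroup.Build diff1p diff1p_compA diff1p_id_comp
  diff1p_comp_id diff1p_comp_invl diff1p_comp_invr.

Definition diff1p_jet f : {uniform circle R -> circle R} * {uniform R -> R} :=
  (diff1p_fun f, angle_derivative f).

(* Uniform convergence of f on the circle and of f'; the latter is read in the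
   angle t over all of R, where it is 2 pi-periodic. *)
HB.instance Definition _ :=
  Topological.copy diff1p (initial_topology diff1p_jet).

Lemma diff1p_mulE f g p : (f * g)%g p = f (g p).
Proof. by []. Qed.

Lemma diff1p_denseP (H : set diff1p) :
  dense H <-> forall (f : diff1p) (e : R), 0 < e -> exists2 g, H g &
    (forall p, `|set_val (f p) - set_val (g p)| < e) /\
    (forall t, `|angle_derivative f t - angle_derivative g t| < e).
Proof.
split=> [dH f e e0|h O [f Of] oO].
- pose W1 : set {uniform circle R -> circle R} :=
    [set h | forall p, setT p -> ball (f p) e (h p)].
  pose W2 : set {uniform R -> R} :=
    [set h | forall p, setT p -> ball (angle_derivative f p) e (h p)].
  have n1 : nbhs (diff1p_fun f : {uniform circle R -> circle R}) W1.
    apply/uniform_nbhs; exists [set xy | ball xy.1 e xy.2]; split; last by [].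
    by rewrite -entourage_ballE; exists e.
  have n2 : nbhs (angle_derivative f : {uniform R -> R}) W2.
    apply/uniform_nbhs; exists [set xy | ball xy.1 e xy.2]; split; last by [].
    by rewrite -entourage_ballE; exists e.
  have : nbhs (diff1p_jet f) (W1 `*` W2) by exists (W1, W2).
  rewrite nbhsE => -[U [oU Uf] UW].
  have [||g [Ug Hg]] := dH (diff1p_jet @^-1` U); [by exists f|by exists U|].
  exists g => //; have [/= w1 w2] := UW _ Ug; split=> t.
    have : ball (set_val (f t)) e (set_val (g t)) := w1 t I.
    by rewrite -ball_normE.
  by have := w2 t I; rewrite -ball_normE.
- case: oO => U oU UO; rewrite -UO.
  have : nbhs (diff1p_jet f) U by apply: open_nbhs_nbhs; split=> //; rewrite -UO in Of.
  case=> -[W1 W2] /= [/uniform_nbhs[E1 [+ s1]] /uniform_nbhs[E2 [+ s2]]] sU.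
  rewrite -!entourage_ballE => -[e1 /= e10 b1] [e2 /= e20 b2].
  have [|g Hg [g1 g2]] := h f (Num.min e1 e2); first by rewrite lt_min e10.
  exists g; split=> //; apply: sU; split => /=.
    apply: s1 => p _; apply: b1 => /=.
    have := g1 p; rewrite lt_min => /andP[+ _] => h1.
    suff: ball (set_val (f p)) e1 (set_val (g p)) by [].
    by rewrite -ball_normE.
  apply: s2 => p _; apply: b2 => /=.
  by have := g2 p; rewrite lt_min => /andP[_ +]; rewrite -ball_normE.
Qed.

End Diff1p.

Section Subgroups.
Variable G : groupType.

Definition subgroup (H : set G) : Prop := group_closed (mem H).

Definition generated_subgroup (S : set G) : set G := smallest subgroup S.

Definition finitely_generated (H : set G) : Prop :=
  exists S : set G, finite_set S /\ H = generated_subgroup S.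

End Subgroups.

(* Main.v *)
Require Import Defs.
From HB Require Import structures.
From mathcomp Require Import all_boot all_order all_algebra.
From mathcomp Require Import ring lra zify.
From mathcomp Require Import all_classical all_reals all_analysis.

Set Implicit Arguments.
Unset Strict Implicit.
Unset Printing Implicit Defensive.

Import Order.TTheory GRing.Theory Num.Theory.
Import numFieldNormedType.Exports.

Local Open Scope classical_set_scope.
Local Open Scope ring_scope.

(** The closure of the generated subgroup [H] has a "Lie algebra": the
    C^{1,1} vector fields [u] such that [id + e u] is within [o(e)], in C^1, of
    an element of [H]. It is a C^1-closed linear space. With the rotation by
    [2 pi sqrt 2] among the generators, it contains the constants and is
    translation invariant. The other generator is [k x = x - (4/5) sin x]:
    conjugating the rotations by [k^-1] gives the field [1 / k'], which is a
    Poisson kernel. All its Fourier coefficients are nonzero, so the Lie algebra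
    contains every trigonometric polynomial, hence every periodic field. The
    segment [F_s = id + s (F - id)] from the identity to a smooth lift [F] has
    velocity [(F - id) \o F_s^-1], and integrating these velocities shows that
    [F] is in the closure of [H]. *)

(** Why C^{1,1}: differentiating a composite [P \o Q] produces [u1 (Q x) - u1 x], and only a
    Lipschitz bound on [u1] turns this into O(e^2). A general lift is merely C^1, so it is first
    averaged over short intervals.

    The rate o(e) depends on the field, so no common lower bound on the step lengths along the path
    is available. A supremum argument on [0, 1] therefore replaces a fixed subdivision; the
    accumulated error obeys a Gronwall estimate, because the C^{1,1} constants of the velocities are
    uniform along the path.

    The constant 4/5 is 2 r / (1 + r^2) at r = 1/2, the parameter of the Poisson kernel. Linearity
    gives only finite combinations of translates, so Fourier modes are extracted by exact sums over
    equally spaced nodes instead of integrals. *)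

Local Notation tau := (pi *+ 2).

(** * Calculus on the line: mean values, primitives, periodic functions *)

Section RealFunctions.
Context {R : realType}.
Implicit Types (f g F D : R -> R) (K x y t : R).

Lemma is_derive_continuous f f1 :
  (forall x, is_derive x 1 f (f1 x)) -> continuous f.
Proof. by move=> df x; apply: derivable_cvg; case: (df x). Qed.

Lemma is_derive_translate (V : normedModType R) (c : R -> V) (a t : R) v :
  is_derive (t + a) 1 c v -> is_derive t 1 (fun x => c (x + a)) v.
Proof.
move=> dc; have dshift : is_derive t 1 (id + cst a) (1 + 0).
  exact: is_deriveD.
have := is_derive_comp1 dshift dc; by rewrite addr0 scale1r.
Qed.

Lemma mean_value f f1 x y : (forall x, is_derive x 1 f (f1 x)) ->
  exists2 c, `|c - x| <= `|y - x| & f y - f x = f1 c * (y - x).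
Proof.
move=> df.
have cf a b : {within `[a, b], continuous f}.
  by apply: continuous_subspaceT; exact: is_derive_continuous df.
have [xy|yx] := leP x y.
  have [c] := MVT_segment xy (fun z _ => df z) (cf x y).
  rewrite in_itv/= => /andP[xc cy] cE; exists c => //.
  by rewrite !ger0_norm ?subr_ge0// lerD2r.
have [c] := MVT_segment (ltW yx) (fun z _ => df z) (cf y x).
rewrite in_itv/= => /andP[yc cx] cE; exists c.
  by rewrite !ler0_norm ?subr_le0 ?(ltW yx)// !opprB lerD2l lerN2.
by rewrite -[LHS]opprB cE; ring.
Qed.

Lemma lipschitz_of_derive f f1 K : (forall x, is_derive x 1 f (f1 x)) ->
  (forall x, `|f1 x| <= K) -> forall x y, `|f x - f y| <= K * `|x - y|.
Proof.
move=> df fK x y; have [c _ ->] := mean_value y x df.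
by rewrite normrM ler_wpM2r.
Qed.

Lemma eq_derive_cst f g f1 x : (forall t : R, is_derive t 1 f (f1 t)) ->
  (forall t : R, is_derive t 1 g (f1 t)) -> forall t, f t - g t = f x - g x.
Proof.
move=> df dg t.
have d (z : R) : is_derive z 1 (f \- g) 0.
  by rewrite -(subrr (f1 z)); exact: is_deriveB.
by have := is_derive_0_is_cst t x d.
Qed.

Lemma increasing_of_derive f f1 : (forall x, is_derive x 1 f (f1 x)) ->
  (forall x, 0 < f1 x) -> forall x y, x < y -> f x < f y.
Proof.
move=> df f1_gt0 x y xy; have [c _ cE] := mean_value x y df.
by rewrite -subr_gt0 cE mulr_gt0 ?subr_gt0.
Qed.

Lemma continuous_primitive_segment D (A : R) : 0 < A -> continuous D ->
  exists F, F 0 = 0 /\ forall x : R, `|x| < A -> is_derive x 1 F (D x).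
Proof.
move=> A0 cD.
pose G y := (\int[@lebesgue_measure R]_(t in [set` `[- A, y]%R]) D t)%R.
exists (fun y => G y - G 0); split; first by rewrite subrr.
move=> x; rewrite ltr_norml => /andP[xA Ax].
have iD : (@lebesgue_measure R).-integrable `[- A, A] (EFin \o D).
  apply: continuous_compact_integrable; first exact: segment_compact.
  exact: continuous_subspaceT.
have [dG eG] := continuous_FTC1_closed Ax iD xA (cD x).
have := derivable_is_derive dG; rewrite eG => dG'.
by rewrite -[X in is_derive _ _ _ X]subr0; exact: is_deriveB.
Qed.

(** Primitives on growing symmetric intervals, all normalised to vanish at 0, agree on overlaps and
    therefore glue. *)
Lemma continuous_primitive D : continuous D ->
  exists F, forall x : R, is_derive x 1 F (D x).
Proof.
move=> cD.
have n0 (n : nat) : 0 < n.+1%:R :> R by rewrite ltr0n.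
pose F n := projT1 (cid (continuous_primitive_segment (n0 n) cD)).
have FE n : F n 0 = 0 /\ forall x : R, `|x| < n.+1%:R -> is_derive x 1 (F n) (D x).
  by rewrite /F; case: cid.
have F_eq m n x : `|x| < m.+1%:R -> `|x| < n.+1%:R -> F m x = F n x.
  move=> xm xn.
  have dmn (z : R) : `|z| <= `|x| -> is_derive z 1 (F m \- F n) 0.
    move=> zx; rewrite -(subrr (D z)); apply: is_deriveB.
    - by apply: (FE m).2; exact: le_lt_trans xm.
    - by apply: (FE n).2; exact: le_lt_trans xn.
  have H a b : a <= b -> (forall z, a <= z <= b -> `|z| <= `|x|) ->
      F m a - F n a = F m b - F n b.
    move=> ab zab.
    have [||c cab] := @MVT_segment R (F m \- F n) (cst 0) a b ab.
    - move=> z; rewrite in_itv/= => /andP[az zb].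
      by apply: dmn; apply: zab; rewrite !ltW.
    - apply: derivable_within_continuous => z; rewrite in_itv/= => abz.
      by case: (dmn z (zab z abz)).
    - by rewrite /= mul0r => /eqP; rewrite subr_eq0 => /eqP ->.
  have : F m x - F n x = F m 0 - F n 0.
    have [x0|x0] := leP 0 x.
      apply/esym/H => // z /andP[z0 zx].
      by rewrite !ger0_norm.
    apply: H => [|z /andP[xz z0]]; first exact: ltW.
    by rewrite ler0_norm// ltr0_norm// lerN2.
  by rewrite (FE m).1 (FE n).1 subrr => /eqP; rewrite subr_eq0 => /eqP.
(* The index jumps at integers, so differentiability at [x] is read off from one fixed primitive
   [F n], whose interval contains a neighbourhood of [x]. *)
exists (fun x => F (Num.truncn `|x|) x) => x.
set n := (Num.truncn `|x|).+1.
have xn : `|x| < n%:R by rewrite /n truncnS_gt.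
have xn1 : `|x| < n.+1%:R by rewrite (lt_trans xn)// ltr_nat.
apply: near_eq_is_derive ((FE n).2 x xn1).
have : \forall t \near x, `|t| < n.+1%:R.
  exact: (@cvgr_norm_lt _ _ _ (nbhs x) _ id x cvg_id).
apply: filterS => t tn.
by apply: F_eq => //; exact: truncnS_gt.
Qed.

Lemma shift_int f (a c : R) : (forall t, f (t + a) = f t + c) ->
  forall (m : int) t, f (t + a *~ m) = f t + c *~ m.
Proof.
move=> fa.
have fn (n : nat) t : f (t + a *+ n) = f t + c *+ n.
  by elim: n => [|n IH]; rewrite ?mulr0n ?addr0// !mulrSr addrA fa IH addrA.
case=> n t; first exact: fn.
rewrite !NegzE !mulrNz; apply/eqP; rewrite eq_sym subr_eq -(fn n.+1).
by rewrite subrK.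
Qed.

Lemma periodic_int f : periodic f tau ->
  forall (m : int) t, f (t + tau *~ m) = f t.
Proof.
move=> fP m t; rewrite (@shift_int f _ 0) ?mul0rz ?addr0// => u.
by rewrite addr0 fP.
Qed.

Lemma angle_representative t : exists m : int, `|t + tau *~ m| <= pi.
Proof.
have tau0 : 0 < tau :> R by rewrite pmulrn_lgt0// pi_gt0.
exists (- Num.floor ((t + pi) / tau)).
rewrite mulrNz -mulrzr; set m := (_ %:~R).
have /andP[h1 h2] := floor_itv ((t + pi) / tau).
rewrite intrD -/m in h1 h2.
move: h1 h2; rewrite ler_pdivlMr// ltr_pdivrMr// => h1 h2.
by rewrite ler_norml; apply/andP; split; lra.
Qed.

Lemma expi_tau t : expi (t + tau) = expi t.
Proof. by apply/circle_eqP; rewrite !set_valE/= cosD2pi sinD2pi. Qed.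

Lemma expi_int (m : int) t : expi (t + tau *~ m) = expi t.
Proof.
by apply/circle_eqP; rewrite !set_valE/= (periodic_int (@cosD2pi R))
  (periodic_int (@sinD2pi R)).
Qed.

Lemma expi_eq t (s : R) : expi t = expi s -> exists m : int, t = s + tau *~ m.
Proof.
move=> /(congr1 set_val); rewrite !set_valE/= => -[ct st].
have [m tsm] := angle_representative (t - s); exists (- m).
have : cos `|t - s + tau *~ m| = cos 0.
  rewrite cos_norm (periodic_int (@cosD2pi R)) cosB ct st -!expr2 cos2Dsin2.
  by rewrite cos0.
move=> /cos_inj -/(_ _ _)/eqP; rewrite !in_itv/= lexx pi_ge0 normr_ge0 tsm.
rewrite normr_eq0 => /(_ isT isT)/eqP h.
by rewrite mulrNz; lra.
Qed.

Lemma periodic_bound f : continuous f -> periodic f tau ->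
  exists K, forall t, `|f t| <= K.
Proof.
move=> cf fP; have pi0 : - pi <= pi :> R by rewrite ge0_cp ?pi_ge0.
have [|c _ cmax] := @EVT_max R (fun t => `|f t|) _ _ pi0.
  apply: continuous_subspaceT => x; apply: continuous_comp; first exact: cf.
  exact: norm_continuous.
exists `|f c| => t; have [m tm] := angle_representative t.
by rewrite -(periodic_int fP m); apply: cmax; rewrite in_itv/= -ler_norml.
Qed.

Lemma periodic_lower_bound f : continuous f -> periodic f tau ->
  (forall t, 0 < f t) -> exists2 c, 0 < c & forall t, c <= f t.
Proof.
move=> cf fP f0; have pi0 : - pi <= pi :> R by rewrite ge0_cp ?pi_ge0.
have [|c _ cmin] := @EVT_min R f _ _ pi0; first exact: continuous_subspaceT.
exists (f c) => // t; have [m tm] := angle_representative t.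
by rewrite -(periodic_int fP m t) cmin// in_itv/= -ler_norml.
Qed.

Lemma periodic_unif_continuous f (e : R) : continuous f -> periodic f tau ->
  0 < e -> exists2 s : R, 0 < s & forall x y, `|x - y| < s -> `|f x - f y| < e.
Proof.
move=> cf fP e0.
(* Compactness of one period turns continuity of [f (x + h) - f x] at [h = 0] into a single bound on
   [h], valid for all base points. *)
have /compact_near_coveringP := @segment_compact R (- pi) pi.
move=> /(_ R (nbhs 0) (fun h x => `|f (x + h) - f x| < e) _) [|s /= s0 hs].
  move=> x _.
  have : (f (z.1 + z.2) - f z.1) @[z --> (x, 0 : R)] --> f (x + 0) - f x.
    apply: cvgB.
      apply: (@cvg_comp _ _ _ (fun z : R * R => z.1 + z.2) f); last exact: cf.
      by apply: cvgD; [exact: cvg_fst|exact: cvg_snd].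
    by apply: (@cvg_comp _ _ _ fst f); [exact: cvg_fst|exact: cf].
  rewrite addr0 subrr => /cvgr_norm_lt; rewrite normr0 => /(_ _ e0).
  by [].
exists s => // x y xy.
have [m ym] := angle_representative y.
have := hs (x - y) _ (y + tau *~ m) _.
rewrite /ball/= sub0r normrN => /(_ xy).
rewrite in_itv/= -ler_norml => /(_ ym).
by rewrite (addrC (y + _)) addrA subrK !(periodic_int fP m).
Qed.

End RealFunctions.

(** * Lifts of circle diffeomorphisms to the line *)

Section Lifts.
Context {R : realType}.
Implicit Types (F G J : R -> R) (t x y : R).

(** These are the lifts of orientation-preserving C^1 diffeomorphisms of the circle; the last clause
    says that the degree is one. The derivative is a separate argument so that composites and
    inverses carry explicit formulas. *)
Definition clift F (F1 : R -> R) := [/\ forall x, is_derive x 1 F (F1 x),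
  continuous F1, forall x, 0 < F1 x & forall x, F (x + tau) = F x + tau].

Lemma tau_gt0 : 0 < tau :> R.
Proof. by rewrite pmulrn_lgt0// pi_gt0. Qed.

Lemma clift_inj F F1 : clift F F1 -> injective F.
Proof.
move=> [dF _ F0 _] x y e; have [xy|yx|//] := ltgtP x y.
  by have := increasing_of_derive dF F0 xy; rewrite e ltxx.
by have := increasing_of_derive dF F0 yx; rewrite e ltxx.
Qed.

Lemma clift_surj F F1 : clift F F1 -> forall y, exists x, F x = y.
Proof.
move=> [dF _ F0 FP] y.
(* A translate of [y] by a multiple of [tau] lies within [pi] of [F 0], hence between [F (- tau)]
   and [F tau]. *)
have [m ym] := angle_representative (y - F 0); set z := y + tau *~ m.
have tau0 := tau_gt0.
have h1 : F (- tau) = F 0 - tau by rewrite -[in F 0](addNr tau) FP addrK.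
have h2 : F tau = F 0 + tau by rewrite -FP add0r.
have [|||x _ xz] := @IVT R F (- tau) tau z; first by lra.
- exact: continuous_subspaceT (is_derive_continuous dF).
- move: ym; rewrite ler_norml => /andP[y1 y2].
  have p0 := @pi_gt0 R.
  rewrite h1 h2 ge_min le_max /z; apply/andP; split; apply/orP; [left|right]; lra.
exists (x + tau *~ (- m)).
by rewrite (shift_int FP) xz /z mulrNz addrK.
Qed.

Lemma clift_inverse F F1 : clift F F1 ->
  exists J, [/\ cancel F J, cancel J F & clift J (fun y => (F1 (J y))^-1)].
Proof.
move=> FL; have [dF cF1 F0 FP] := FL.
pose J y := projT1 (cid (clift_surj FL y)).
have JK : cancel J F by move=> y; rewrite /J; case: cid.
have FK : cancel F J by move=> x; apply: (clift_inj FL); rewrite JK.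
have dJ y : is_derive y 1 J (F1 (J y))^-1.
  have nK : {near J y, cancel F J} by apply: (@nearW _ (nbhs (J y))).
  have nC : {near J y, continuous F}.
    apply: (@nearW _ (nbhs (J y))) => x; exact: is_derive_continuous dF x.
  have := is_derive_inverse nK nC (dF (J y)); rewrite JK; apply.
  by rewrite gt_eqF.
exists J; split=> //; split=> //.
- move=> y; apply: cvgV; first by rewrite gt_eqF.
  by apply: continuous_comp; [exact: is_derive_continuous dJ y|exact: cF1].
- by move=> y; rewrite invr_gt0.
- by move=> y; apply: (clift_inj FL); rewrite FP !JK.
Qed.

Lemma clift_comp F F1 G G1 : clift F F1 -> clift G G1 ->
  clift (F \o G) (fun x => F1 (G x) * G1 x).
Proof.
move=> [dF cF F0 FP] [dG cG G0 GP]; split.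
- by move=> x; exact: is_derive1_comp.
- move=> x; apply: cvgM; last exact: cG.
  by apply: continuous_comp; [exact: is_derive_continuous dG x|exact: cF].
- by move=> x; rewrite mulr_gt0.
- by move=> x /=; rewrite GP FP.
Qed.

Section CurveOfLift.
Variables (f : circle R -> circle R) (F F1 : R -> R).
Hypothesis fF : forall t, f (expi t) = expi (F t).

Lemma is_derive_angle_curve_lift t : is_derive t 1 F (F1 t) ->
  is_derive t 1 (angle_curve f) (F1 t *: (- sin (F t), cos (F t))).
Proof.
move=> dF; have -> : angle_curve f = angle_curve id \o F.
  by apply/funext => x; rewrite /angle_curve/= fF.
exact: is_derive_comp1 (is_derive_angle_curve_id _).
Qed.

Lemma angle_derivative_lift t : is_derive t 1 F (F1 t) ->
  angle_derivative f t = F1 t.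
Proof.
move=> dF; rewrite /angle_derivative.
rewrite (is_derive_derive1 (is_derive_angle_curve_lift dF)).
rewrite /angle_curve fF set_valE/= /GRing.scale/=.
by rewrite -[RHS](mulr1 _) -(cos2Dsin2 (F t)); ring.
Qed.

Lemma is_C1_lift : (forall t, is_derive t 1 F (F1 t)) -> continuous F1 ->
  is_C1 f.
Proof.
move=> dF cF1; split=> t; first by case: (is_derive_angle_curve_lift (dF t)).
have -> : derive1 (angle_curve f) = fun t => F1 t *: (- sin (F t), cos (F t)).
  apply/funext => x; exact: is_derive_derive1 (is_derive_angle_curve_lift _).
apply: cvgZ; first exact: cF1.
have cF : {for t, continuous F} := is_derive_continuous dF (x := t).
have s : - sin (F x) @[x --> t] --> - sin (F t).
  by apply: cvgN; apply: continuous_comp; [exact: cF|exact: continuous_sin].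
have c : cos (F x) @[x --> t] --> cos (F t).
  by apply: continuous_comp; [exact: cF|exact: continuous_cos].
exact: (cvg_pair s c).
Qed.

End CurveOfLift.

Lemma circle_map_of_lift F : (forall x, F (x + tau) = F x + tau) ->
  exists f : circle R -> circle R, forall t, f (expi t) = expi (F t).
Proof.
move=> FP; exists (fun p => expi (F (projT1 (cid (expi_surj p))))) => t.
case: cid => s /= /expi_eq[m ->].
by rewrite (shift_int FP) expi_int.
Qed.

Lemma diff1p_of_lift F F1 : clift F F1 ->
  exists f : diff1p R, forall t, f (expi t) = expi (F t).
Proof.
move=> FL; have [J [FK JK JL]] := clift_inverse FL.
have [dF cF1 F0 FP] := FL; have [dJ cJ1 _ JP] := JL.
have [f fF] := circle_map_of_lift FP; have [g gJ] := circle_map_of_lift JP.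
have f_diffeo : is_C1_diffeo f.
  split; first exact: is_C1_lift fF dF cF1.
  exists g; split.
  - by move=> p; have [t <-] := expi_surj p; rewrite fF gJ FK.
  - by move=> p; have [t <-] := expi_surj p; rewrite gJ fF JK.
  - exact: is_C1_lift gJ dJ cJ1.
have f_pos : orientation_preserving f.
  by move=> t; rewrite (angle_derivative_lift fF (dF t)).
by exists (Diff1p f_diffeo f_pos).
Qed.

Lemma angle_derivative_periodic (f : circle R -> circle R) : is_C1 f ->
  periodic (angle_derivative f) tau.
Proof.
move=> [df _] t.
have cP x : angle_curve f (x + tau) = angle_curve f x.
  by rewrite /angle_curve expi_tau.
have d : is_derive t 1 (angle_curve f) (derive1 (angle_curve f) (t + tau)).
  rewrite [X in is_derive _ _ X _](_ : _ = fun x => angle_curve f (x + tau)).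
    exact/is_derive_translate/derivable_is_derive.
  by apply/funext => x; rewrite cP.
by rewrite /angle_derivative cP (is_derive_derive1 d).
Qed.

(** Differentiating |a|^2 = 1 makes the velocity orthogonal to the position, hence a multiple of the
    position turned by a right angle. *)
Lemma local_velocity (f : circle R -> circle R) t : is_C1 f ->
  derive1 (angle_curve f) t = angle_derivative f t *:
    (- (angle_curve f t).2, (angle_curve f t).1).
Proof.
move=> [df _]; have /is_derive_pairP[d1 d2] := derivable_is_derive (df t).
rewrite /angle_derivative.
set a := angle_curve f; set v := derive1 _ t in d1 d2 *.
have E x : (a x).1 ^+ 2 + (a x).2 ^+ 2 = 1 by exact: circleE.
have h : is_derive t 1 ((fst \o a) * (fst \o a) + (snd \o a) * (snd \o a)) 0.
  rewrite (_ : _ + _ = cst 1); first exact: is_derive_cst.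
  by apply/funext => x; rewrite !fctE /= -(E x) !expr2.
have h' := is_deriveD (is_deriveM d1 d1) (is_deriveM d2 d2).
have tangent (p q u w : R) : p ^+ 2 + q ^+ 2 = 1 ->
    p * u + p * u + (q * w + q * w) = 0 ->
    u = (p * w - q * u) * - q /\ w = (p * w - q * u) * p.
  move=> pq puqw; have e0 : p * u + q * w = 0 by lra.
  split; apply/eqP; rewrite -subr_eq0.
    rewrite [X in X == 0](_ : _ = p * (p * u + q * w)
      + (1 - (p ^+ 2 + q ^+ 2)) * u); last by ring.
    by rewrite e0 pq subrr mulr0 mul0r addr0.
  rewrite [X in X == 0](_ : _ = q * (p * u + q * w)
    + (1 - (p ^+ 2 + q ^+ 2)) * w); last by ring.
  by rewrite e0 pq subrr mulr0 mul0r addr0.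
have [|v1E v2E] := tangent _ _ v.1 v.2 (E t).
  by have := is_derive_derive1 h; rewrite (is_derive_derive1 h').
by rewrite [LHS]surjective_pairing; congr (_, _).
Qed.

(** The lift is a primitive of the angle derivative; what remains is that it really lifts [f] and
    that its degree is one. *)
Lemma diff1p_lift (f : diff1p R) : exists F, clift F (angle_derivative f) /\
  forall t, f (expi t) = expi (F t).
Proof.
have [fC _] := diff1p_C1 f; set D := angle_derivative f.
have cD : continuous D := angle_derivative_continuous fC.
have [G dG] := continuous_primitive cD.
have [s0 s0E] := expi_surj (f (expi 0)).
pose F : R -> R := G + cst (s0 - G 0).
have F0 : F 0 = s0 by rewrite /F !fctE; ring.
have dF t : is_derive t 1 F (D t).
  by rewrite -[X in is_derive _ _ _ X]addr0; exact: is_deriveD.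
move: F F0 dF => F F0 dF.
pose a := angle_curve f.
have E x : (a x).1 ^+ 2 + (a x).2 ^+ 2 = 1 by exact: circleE.
(* Inner product of the unit vectors (cos F, sin F) and [a]. Its derivative is 0 and its value at 0
   is 1, so the two vectors coincide everywhere. *)
pose c : R -> R := (cos \o F) * (fst \o a) + (sin \o F) * (snd \o a).
have dc t : is_derive t 1 c 0.
  have := derivable_is_derive (fC.1 t); rewrite (local_velocity _ fC) -/D.
  move=> /is_derive_pairP[d1 d2].
  have dcos : is_derive t 1 (cos \o F) (- sin (F t) * D t).
    exact: is_derive1_comp.
  have dsin : is_derive t 1 (sin \o F) (cos (F t) * D t).
    exact: is_derive1_comp.
  apply: is_derive_eq (is_deriveD (is_deriveM dcos d1) (is_deriveM dsin d2)) _.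
  by rewrite /GRing.scale /= /GRing.scale /= /a; ring.
have c1 t : c t = 1.
  have := is_derive_0_is_cst t 0 dc => ->.
  by rewrite /c !fctE /= F0 /a /angle_curve -s0E set_valE/= -!expr2 cos2Dsin2.
have fF t : f (expi t) = expi (F t).
  apply/circle_eqP; rewrite [LHS]surjective_pairing -/(angle_curve f t) -/a.
  have -> : set_val (expi (F t)) = (cos (F t), sin (F t)) by rewrite set_valE.
  have := c1 t; rewrite /c !fctE/=.
  have := E t; have := cos2Dsin2 (F t).
  move: (cos _) (sin _) (a t).1 (a t).2 => p q u w pq uw dot.
  have : (u - p) ^+ 2 + (w - q) ^+ 2 = 0 by move: pq uw dot; nra.
  move/eqP; rewrite paddr_eq0 ?sqr_ge0// !sqrf_eq0 !subr_eq0.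
  by move=> /andP[/eqP -> /eqP ->].
have D0 t : 0 < D t by exact: diff1p_pos.
have [m mE] : exists m : int, F tau = F 0 + tau *~ m.
  by apply: expi_eq; rewrite -!fF -[in LHS](add0r tau) expi_tau.
have FP t : F (t + tau) = F t + tau *~ m.
  have dFt (z : R) : is_derive z 1 (fun x => F (x + tau)) (D z).
    by rewrite /D -(angle_derivative_periodic fC); exact: is_derive_translate.
  have := eq_derive_cst 0 dFt dF t.
  by rewrite /= add0r mE => /eqP; rewrite subr_eq => /eqP ->; ring.
have tau0 := tau_gt0.
have m0 : 0 < m.
  have := increasing_of_derive dF D0 tau0.
  by rewrite mE ltrDl -mulrzr pmulr_rgt0// ltr0z.
(* A degree above one contradicts injectivity: [F] would reach [F 0 + tau] strictly between 0 and
   [tau], where [f] would repeat its value at [expi 0]. *)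
have m1 : (m <= 1)%R.
  rewrite leNgt; apply/negP => m_gt1.
  have tm : tau < tau *~ m :> R.
    by rewrite -[_ *~ m]mulrzr ltr_pMr// ltr1z.
  have [|||t tI tE] := @IVT R F 0 tau (F 0 + tau); first exact: ltW.
  - exact: continuous_subspaceT (is_derive_continuous dF).
  - by rewrite mE ge_min le_max; apply/andP; split; apply/orP; [left|right]; lra.
  have : expi t = expi 0.
    by apply: (can_inj (diff1p_funK f)); rewrite !fF tE expi_tau.
  move=> /expi_eq[n]; rewrite add0r => tn.
  have lt_t : t < tau.
    move: tI; rewrite in_itv/= => /andP[_]; rewrite le_eqVlt => /orP[/eqP t1|//].
    by move: tE; rewrite t1 mE => /addrI tmE; rewrite tmE ltxx in tm.
  have t_gt0 : 0 < t.
    move: tI; rewrite in_itv/= => /andP[]; rewrite le_eqVlt => /orP[/eqP t1|//].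
    by move: tE; rewrite -t1 => /eqP; rewrite -subr_eq0 opprD addNKr oppr_eq0 gt_eqF.
  move: lt_t t_gt0; rewrite tn -mulrzr pmulr_rgt0// ltr0z gtr_pMr// ltrz1.
  lia.
have m_eq1 : m = 1 by apply/eqP; rewrite eq_le m1 -gtz0_ge1.
exists F; split=> //; split=> // t.
by rewrite FP m_eq1.
Qed.

End Lifts.

Section NormBounds.
Context {R : realType}.
Implicit Types x y a b : R.

Lemma norm_addW x y a b : `|x| <= a -> `|y| <= b -> `|x + y| <= a + b.
Proof. by move=> xa yb; rewrite (le_trans (ler_normD _ _))// lerD. Qed.

Lemma norm_mulW x y a b : `|x| <= a -> `|y| <= b -> `|x * y| <= a * b.
Proof. by move=> xa yb; rewrite normrM ler_pM. Qed.

End NormBounds.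

(** * The Lie algebra: linearity, C^1 closedness, invariance under translations *)

Section TangentFields.
Context {R : realType}.
Variable H : set (diff1p R).
Hypothesis Hgrp : subgroup H.
Implicit Types (F G J P Q u v : R -> R) (x y s t e d K : R).

Definition lift_in F (F1 : R -> R) :=
  clift F F1 /\ exists2 g, H g & forall t, g (expi t) = expi (F t).

Lemma lift_in_comp F F1 G G1 : lift_in F F1 -> lift_in G G1 ->
  lift_in (F \o G) (fun x => F1 (G x) * G1 x).
Proof.
move=> [FL [f Hf fF]] [GL [g Hg gG]]; split; first exact: clift_comp.
exists (f * g)%g; last by move=> t; rewrite diff1p_mulE gG fF.
have := @group_closedM _ (mem H) Hgrp f g.
by rewrite !in_setE; apply.
Qed.

Lemma lift_in_inverse F F1 : lift_in F F1 -> exists J, [/\ cancel F J,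
  cancel J F & lift_in J (fun y => (F1 (J y))^-1)].
Proof.
move=> [FL [f Hf fF]]; have [J [FK JK JL]] := clift_inverse FL.
exists J; split=> //; split=> //; exists (f^-1)%g.
  have := @group_closedV _ (mem H) Hgrp f.
  by rewrite !in_setE; apply.
move=> t; rewrite -{1}(JK t) -fF; exact: (diff1p_funK f).
Qed.

Lemma lift_in_tau (m : int) : lift_in (fun x => x + tau *~ m) (cst 1).
Proof.
split; last first.
  exists 1%g; first by have [+ _] := Hgrp; rewrite in_setE.
  by move=> t; rewrite expi_int.
split=> [x||x|x].
- exact: is_derive_translate.
- exact: cst_continuous.
- exact: ltr01.
- by rewrite addrAC.
Qed.

Lemma lift_in_id : lift_in id (cst 1).
Proof.
have := lift_in_tau 0; rewrite (_ : (fun x => _) = id)//.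
by apply/funext => x; rewrite mulr0z addr0.
Qed.

Definition rotation_in s := lift_in (fun x => x + s) (cst 1).

Lemma rotation_inD s t : rotation_in s -> rotation_in t -> rotation_in (s + t).
Proof.
move=> sr tr; have := lift_in_comp tr sr; rewrite /rotation_in.
rewrite (_ : _ \o _ = fun x => x + (s + t)); last first.
  by apply/funext => x /=; rewrite addrA.
by rewrite (_ : (fun x => _ * _) = cst 1)//; apply/funext => x; rewrite /= mulr1.
Qed.

Lemma rotation_inN s : rotation_in s -> rotation_in (- s).
Proof.
move=> /lift_in_inverse[J [_ JK]]; rewrite /rotation_in.
rewrite (_ : (fun x => x - s) = J); last first.
  by apply/funext => x; rewrite -{1}(JK x) addrK.
by rewrite (_ : (fun y => _) = cst 1)//; apply/funext => x; rewrite /= invr1.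
Qed.

Lemma rotation_in_int s (m : int) : rotation_in s -> rotation_in (s *~ m).
Proof.
move=> sr; have n_in (n : nat) : rotation_in (s *+ n).
  elim: n => [|n IH]; last by rewrite mulrS; exact: rotation_inD.
  by have := lift_in_tau 0; rewrite mulr0z.
case: m => n; first exact: n_in.
by rewrite NegzE mulrNz; apply: rotation_inN; exact: n_in.
Qed.

(* The powers of [sqrt 2 - 1] are arbitrarily small elements of
   [Z + Z sqrt 2]. *)
Lemma rotation_in_dense s e : rotation_in (tau * Num.sqrt 2) -> 0 < e ->
  exists2 r, rotation_in r & `|r - s| <= e.
Proof.
move=> r2 e0; set q := Num.sqrt 2 in r2 *.
have qq : q ^+ 2 = 2 by rewrite sqr_sqrtr.
have q0 : 0 <= q by exact: sqrtr_ge0.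
have q1 : 1 < q by nra.
have q2 : q < 3 / 2 by nra.
have Zq (n : nat) : exists a b : int, (q - 1) ^+ n = a%:~R + b%:~R * q.
  elim: n => [|n [a [b IH]]]; first by exists 1, 0; rewrite expr0 mul0r addr0.
  exists (2 * b - a), (a - b); rewrite exprS IH !intrD !mulrNz intrM.
  have -> : (q - 1) * (a%:~R + b%:~R * q) =
    a%:~R * q - a%:~R + b%:~R * q ^+ 2 - b%:~R * q by ring.
  by rewrite qq; ring.
have small (n : nat) : rotation_in (tau * (q - 1) ^+ n).
  have [a [b ->]] := Zq n; rewrite mulrDr; apply: rotation_inD.
    by rewrite mulrzr; exact: lift_in_tau.
  by rewrite mulrCA mulrzl; exact: rotation_in_int.
have tau0 := @tau_gt0 R.
have [n hn] : exists n : nat, tau * (q - 1) ^+ n <= e.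
  (* Since q - 1 < 1/2 and n <= 2^n, the product is at most tau / n, which is below [e]. *)
  pose n := (Num.truncn (tau / e)).+1; exists n.
  have nE : tau < n%:R * e by rewrite -ltr_pdivrMr//; exact: truncnS_gt.
  have : (q - 1) ^+ n <= (2^-1) ^+ n by apply: lerXn2r; rewrite ?nnegrE; lra.
  have : n%:R <= 2 ^+ n :> R by rewrite -natrX ler_nat ltnW// ltn_expl.
  rewrite exprVn; set N : R := 2 ^+ n => nN qN.
  have N0 : 0 < N by rewrite exprn_gt0.
  have : tau * (q - 1) ^+ n <= tau * N^-1 by rewrite ler_wpM2l// ltW.
  move=> /le_trans; apply; rewrite ler_pdivrMr//.
  by rewrite (le_trans (ltW nE))// mulrC ler_wpM2l// ltW.
set r := tau * (q - 1) ^+ n in hn *.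
have r0 : 0 < r by rewrite mulr_gt0// exprn_gt0// subr_gt0.
exists (r *~ Num.floor (s / r)); first exact/rotation_in_int/small.
have /andP[h1 h2] := floor_itv (s / r).
move: h1 h2; rewrite intrD ler_pdivlMr// ltr_pdivrMr// -mulrzl.
set m := (_ %:~R) => h1 h2.
by rewrite ler_norml; apply/andP; split; lra.
Qed.

(** One constant bounds the field, its derivative and the Lipschitz constant of the derivative; this
    keeps the error estimates to a single parameter per field. *)
Definition C11 K u (u1 : R -> R) := [/\ forall x, is_derive x 1 u (u1 x),
  forall x, `|u x| <= K, forall x, `|u1 x| <= K &
  forall x y, `|u1 x - u1 y| <= K * `|x - y|].

Definition C1_near e F (F1 : R -> R) G (G1 : R -> R) :=
  forall x, `|F x - G x| <= e /\ `|F1 x - G1 x| <= e.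

(* [tangent u u1] says that the vector field [u], of derivative [u1], belongs
   to the Lie algebra of the closure of [H]. *)
Definition tangent u (u1 : R -> R) := (exists K, C11 K u u1) /\
  forall d, 0 < d -> exists2 e0, 0 < e0 & forall e, `|e| < e0 ->
    exists P P1, lift_in P P1 /\ C1_near (d * `|e|) P P1
      (fun x => x + e * u x) (fun x => 1 + e * u1 x).

Lemma C11_ge0 K u u1 : C11 K u u1 -> 0 <= K.
Proof. by move=> [_ uK _ _]; rewrite (le_trans _ (uK 0)). Qed.

Lemma C11_le K K' u u1 : C11 K u u1 -> K <= K' -> C11 K' u u1.
Proof.
move=> [du uK u1K u1L] KK'; split=> // x; rewrite ?(le_trans _ KK')//.
by move=> y; rewrite (le_trans (u1L x y))// ler_wpM2r.
Qed.

Lemma C11_lipschitz K u u1 : C11 K u u1 ->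
  forall x y, `|u x - u y| <= K * `|x - y|.
Proof. by move=> [du _ u1K _]; exact: lipschitz_of_derive du u1K. Qed.

Lemma C11D K L u u1 v v1 : C11 K u u1 -> C11 L v v1 ->
  C11 (K + L) (u + v) (fun x => u1 x + v1 x).
Proof.
move=> [du uK u1K u1L] [dv vK v1K v1L]; split=> [x|x|x|x y].
- exact: is_deriveD.
- exact: norm_addW.
- exact: norm_addW.
- rewrite mulrDl (_ : _ - _ = u1 x - u1 y + (v1 x - v1 y)); last by ring.
  exact: norm_addW.
Qed.

Lemma C11Z K c u u1 : C11 K u u1 ->
  C11 (`|c| * K) (c *: u) (fun x => c * u1 x).
Proof.
move=> [du uK u1K u1L]; split=> [x|x|x|x y].
- exact: is_deriveZ.
- exact: norm_mulW.
- exact: norm_mulW.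
- by rewrite -mulrBr -mulrA; exact: norm_mulW.
Qed.

(** Composition adds velocities to first order: if [P] and [Q] follow [id + e u] and [id + e v], the
    remaining terms of [P \o Q] are of order e^2, by the Lipschitz bounds on [u] and [u1]. *)
Lemma tangentD u u1 v v1 : tangent u u1 -> tangent v v1 ->
  tangent (u + v) (fun x => u1 x + v1 x).
Proof.
move=> [[K uC] ut] [[L vC] vt]; split.
  by exists (K + L); exact: C11D.
move=> d d0.
pose M := K + L + 1.
have K0 := C11_ge0 uC; have L0 := C11_ge0 vC.
have M1 : 1 <= M by rewrite /M; lra.
pose d' := Num.min 1 (d / 4).
have d'0 : 0 < d' by rewrite lt_min ltr01 divr_gt0.
have d'1 : d' <= 1 by rewrite ge_min lexx.
have d'd : d' <= d / 4 by rewrite ge_min lexx orbT.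
have [eu eu0 hu] := ut d' d'0; have [ev ev0 hv] := vt d' d'0.
(* At most four error terms occur. Those of [P] and [Q] are below d |e| / 4 by the choice of [d'],
   and [e0] does the same for each term M^2 e^2. *)
pose e0 := d / (4 * M ^+ 2).
have M2 : 0 < M ^+ 2 by rewrite exprn_gt0//; lra.
exists (Num.min (Num.min eu ev) e0).
  by rewrite !lt_min eu0 ev0 divr_gt0// mulr_gt0.
move=> e; rewrite !lt_min => /andP[/andP[eeu eev] ee0].
have [P [P1 [Pin PC]]] := hu e eeu; have [Q [Q1 [Qin QC]]] := hv e eev.
exists (P \o Q), (fun x => P1 (Q x) * Q1 x).
split; first exact: lift_in_comp.
have eM : `|e| * (4 * M ^+ 2) <= d.
  by rewrite -ler_pdivlMr ?(ltW ee0)// mulr_gt0.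
move: PC QC; set D := `|e| in eM * => PC QC x.
have D0 : 0 <= D := normr_ge0 e.
have [_ _ u1K u1L] := uC; have [_ vK v1K v1L] := vC.
have [Pv Pd] := PC (Q x); have [Qv Qd] := QC x.
have d'D : d' * D <= d / 4 * D by rewrite ler_wpM2r.
have d'D1 : d' * D <= D by rewrite ler_piMl.
have dD0 : 0 <= d * D by rewrite mulr_ge0// ltW.
have DDM : D * (D * M ^+ 2) <= D * (d / 4) by rewrite ler_wpM2l//; lra.
have Qx : `|Q x - x| <= D * M.
  rewrite (_ : Q x - x = Q x - (x + e * v x) + e * v x); last by ring.
  apply: le_trans (norm_addW Qv (norm_mulW (lexx D) (vK x))) _.
  rewrite /M; have := mulr_ge0 D0 K0; lra.
split.
  rewrite (_ : _ - _ = P (Q x) - (Q x + e * u (Q x)) + (Q x - (x + e * v x)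
    + e * (u (Q x) - u x))); last by rewrite !fctE /=; ring.
  have uQ : `|u (Q x) - u x| <= M * (D * M).
    apply: le_trans (C11_lipschitz uC _ _) _; apply: ler_pM => //.
    rewrite /M; lra.
  have := norm_addW Pv (norm_addW Qv (norm_mulW (lexx D) uQ)).
  move=> /le_trans; apply; lra.
set a := P1 (Q x) - _ in Pd; set b := Q1 x - _ in Qd.
rewrite (_ : _ - _ = a + (b + (e * (u1 (Q x) - u1 x)
  + (e * u1 (Q x) + a) * (e * v1 x + b)))); last by rewrite /a /b; ring.
have uQ : `|u1 (Q x) - u1 x| <= M * (D * M).
  apply: le_trans (u1L _ _) _; apply: ler_pM => //.
  rewrite /M; lra.
have small c c1 (K' : R) : 0 <= K' -> K' + 1 <= M -> `|c1| <= K' ->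
    `|c| <= d' * D -> `|e * c1 + c| <= D * M.
  move=> K'0 K'M c1K cD.
  apply: le_trans (norm_addW (norm_mulW (lexx D) c1K) cD) _.
  have : D * (K' + 1) <= D * M by rewrite ler_wpM2l.
  lra.
have ua : `|e * u1 (Q x) + a| <= D * M.
  by apply: (small _ _ K) => //; rewrite /M; lra.
have vb : `|e * v1 x + b| <= D * M.
  by apply: (small _ _ L) => //; rewrite /M; lra.
have := norm_addW Pd (norm_addW Qd (norm_addW (norm_mulW (lexx D) uQ)
  (norm_mulW ua vb))).
move=> /le_trans; apply; lra.
Qed.

Lemma tangentZ c u u1 : tangent u u1 -> tangent (c *: u) (fun x => c * u1 x).
Proof.
move=> [[K uC] ut]; split; first by exists (`|c| * K); exact: C11Z.
(* The same diffeomorphism serves at time [e * c]; adding 1 to |c| allows division even when [c] is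
   0. *)
move=> d d0; pose k := `|c| + 1.
have k0 : 0 < k by rewrite ltr_wpDl.
have [e0 e00 he] := ut (d / k) (divr_gt0 d0 k0).
exists (e0 / k); first exact: divr_gt0.
move=> e eE.
have [|P [P1 [Pin PC]]] := he (e * c).
  rewrite normrM; apply: le_lt_trans (_ : `|e| * k < _).
    by rewrite ler_wpM2l// /k lerDl.
  by rewrite -ltr_pdivlMr.
exists P, P1; split=> // x; have [Pv Pd] := PC x.
have le_d : d / k * `|e * c| <= d * `|e|.
  rewrite normrM (_ : _ * _ = d * `|e| * (`|c| / k)); last by ring.
  rewrite ler_piMr// ?mulr_ge0// ?(ltW d0)//.
  by rewrite ler_pdivrMr// mul1r /k lerDl.
split; apply: le_trans le_d.
  by rewrite fctE /GRing.scale/= mulrA.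
by rewrite mulrA.
Qed.

(** The approximant [v] is fixed before [e], so its own C^{1,1} constant may grow without bound as
    [d] shrinks. *)
Lemma tangent_lim K u u1 : C11 K u u1 ->
  (forall d, 0 < d -> exists v v1, tangent v v1 /\ C1_near d v v1 u u1) ->
  tangent u u1.
Proof.
move=> uC happ; split; first by exists K.
move=> d d0; have d20 : 0 < d / 2 by rewrite divr_gt0.
have [v [v1 [[_ vt] vu]]] := happ (d / 2) d20.
have [e0 e00 he] := vt (d / 2) d20; exists e0 => // e /he[P [P1 [Pin PC]]].
exists P, P1; split=> // x; have [Pv Pd] := PC x; have [vux v1ux] := vu x.
split.
  rewrite (_ : _ - _ = P x - (x + e * v x) + e * (v x - u x)); last by ring.
  apply: le_trans (norm_addW Pv (norm_mulW (lexx `|e|) vux)) _; lra.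
rewrite (_ : _ - _ = P1 x - (1 + e * v1 x) + e * (v1 x - u1 x)); last by ring.
apply: le_trans (norm_addW Pd (norm_mulW (lexx `|e|) v1ux)) _; lra.
Qed.

Lemma tangent_sum n (u u1 : 'I_n -> R -> R) :
  (forall i, tangent (u i) (u1 i)) ->
  tangent (fun x => \sum_(i < n) u i x) (fun x => \sum_(i < n) u1 i x).
Proof.
elim: n u u1 => [|n IH] u u1 ut.
  rewrite (_ : (fun x => _) = cst 0); last by apply/funext => x; rewrite big_ord0.
  rewrite (_ : (fun x => \sum_(i < 0) u1 i x) = cst 0); last first.
    by apply/funext => x; rewrite big_ord0.
  split.
    exists 0; split=> [x|x|x|x y] /=; rewrite ?subrr ?normr0 ?mul0r//.
    exact: is_derive_cst.
  move=> d d0; exists 1 => // e _; exists id, (cst 1).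
  split; first exact: lift_in_id.
  by move=> x /=; rewrite mulr0 !addr0 !subrr normr0 mulr_ge0// ltW.
rewrite (_ : (fun x => _) =
  (fun x => \sum_(i < n) u (widen_ord (leqnSn n) i) x) + u ord_max); last first.
  by apply/funext => x; rewrite big_ord_recr.
rewrite (_ : (fun x => \sum_(i < n.+1) u1 i x) = fun x =>
  \sum_(i < n) u1 (widen_ord (leqnSn n) i) x + u1 ord_max x); last first.
  by apply/funext => x; rewrite big_ord_recr.
by apply: tangentD => //; exact: IH.
Qed.

Section Rotations.
Hypothesis Hrot : rotation_in (tau * Num.sqrt 2).

Lemma tangent_cst : tangent (cst 1) (cst 0).
Proof.
split.
  exists 1; split=> [x|x|x|x y] /=; rewrite ?subrr ?normr0 ?normr1 ?mul1r//.
  exact: is_derive_cst.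
move=> d d0; exists 1 => // e _.
have [r r_in re] : exists2 r, rotation_in r & `|r - e| <= d * `|e|.
  have [->|e0] := eqVneq e 0.
    exists 0; last by rewrite subrr normr0 mulr0.
    by have := lift_in_tau 0; rewrite mulr0z.
  by apply: rotation_in_dense => //; rewrite mulr_gt0// normr_gt0.
exists (fun x => x + r), (cst 1); split=> // x; split=> /=.
  by rewrite (_ : _ - _ = r - e)//; ring.
by rewrite mulr0 addr0 subrr normr0 mulr_ge0// ltW.
Qed.

Lemma C11_translate K a u u1 : C11 K u u1 ->
  C11 K (fun x => u (x + a)) (fun x => u1 (x + a)).
Proof.
move=> [du uK u1K u1L]; split=> // [x|x y].
- exact: is_derive_translate.
- apply: le_trans (u1L _ _) _.
  by rewrite (_ : x + a - (y + a) = x - y)//; ring.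
Qed.

(** Conjugation by a rotation preserves C^1 distances and translates the field. The rotation by [a]
    itself may be missing from [H], but a nearby [s], chosen from [d] alone, changes [u] and [u1] by
    at most d / 2. *)
Lemma tangent_translate a u u1 : tangent u u1 ->
  tangent (fun x => u (x + a)) (fun x => u1 (x + a)).
Proof.
move=> [[K uC] ut]; split; first by exists K; exact: C11_translate.
move=> d d0; have d20 : 0 < d / 2 by rewrite divr_gt0.
have K0 := C11_ge0 uC.
have k0 : 0 < K + 1 by rewrite ltr_wpDl.
have [s s_in sa] := rotation_in_dense a Hrot (divr_gt0 d20 k0).
have [e0 e00 he] := ut (d / 2) d20; exists e0 => // e /he[P [P1 [Pin PC]]].
have := lift_in_comp (lift_in_comp (rotation_inN s_in) Pin) s_in.
set Q := (X in lift_in X); set Q1 := (X in lift_in _ X) => Qin.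
exists Q, Q1; split=> // x; rewrite /Q /Q1 /= mul1r mulr1.
have [Pv Pd] := PC (x + s).
have Ks : K * `|x + s - (x + a)| <= d / 2.
  rewrite (_ : x + s - (x + a) = s - a); last by ring.
  have : K * `|s - a| <= K * (d / 2 / (K + 1)) by rewrite ler_wpM2l.
  move=> /le_trans; apply.
  rewrite mulrCA -[leRHS]mulr1 ler_wpM2l ?(ltW d20)//.
  by rewrite ler_pdivrMr// mul1r lerDl.
have us : `|u (x + s) - u (x + a)| <= d / 2.
  exact: le_trans (C11_lipschitz uC _ _) Ks.
have u1s : `|u1 (x + s) - u1 (x + a)| <= d / 2.
  by have [_ _ _ u1L] := uC; exact: le_trans (u1L _ _) Ks.
split.
  rewrite (_ : _ - _ = P (x + s) - (x + s + e * u (x + s)) +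
    e * (u (x + s) - u (x + a))); last by ring.
  apply: le_trans (norm_addW Pv (norm_mulW (lexx `|e|) us)) _; lra.
rewrite (_ : _ - _ = P1 (x + s) - (1 + e * u1 (x + s)) +
  e * (u1 (x + s) - u1 (x + a))); last by ring.
apply: le_trans (norm_addW Pd (norm_mulW (lexx `|e|) u1s)) _; lra.
Qed.

End Rotations.
End TangentFields.

(** * Conjugating the rotations by a diffeomorphism *)

Section AdjointOfRotations.
Context {R : realType}.
Variable H : set (diff1p R).
Hypothesis Hgrp : subgroup H.
Hypothesis Hrot : rotation_in H (tau * Num.sqrt 2).

(* If [J] is the inverse of [k], then [J \o (fun x => x + s) \o k] has
   velocity [w] at [s = 0]. *)
Lemma tangent_adjoint (K : R) (k k1 w w1 : R -> R) : lift_in H k k1 ->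
  C11 K w w1 -> (forall x, k1 x * w x = 1) -> (forall x, `|k1 x| <= 2) ->
  tangent H w w1.
Proof.
move=> k_in wC kw k12; split; first by exists K.
move=> d d0; pose M := K + 1.
have M1 : 1 <= M by rewrite /M lerDr; exact: C11_ge0 wC.
have M0 : 0 < M := lt_le_trans ltr01 M1.
have {wC} wC : C11 M w w1 by apply: C11_le wC _; rewrite /M lerDl.
move: M M1 M0 wC => M M1 M0 wC.
have [J [kJ Jk J_in]] := lift_in_inverse Hgrp k_in.
have [dw wM w1M w1L] := wC; have wL := C11_lipschitz wC.
have invE y : (k1 y)^-1 = w y.
  have k1N0 : k1 y != 0.
    by apply/eqP => k0; move/eqP: (kw y); rewrite k0 mul0r eq_sym oner_eq0.
  by rewrite -[LHS]mulr1 -(kw y) mulKf.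
have dJ (y : R) : is_derive y 1 J (w (J y)).
  have [[dJ _ _ _] _] := J_in; have := dJ y.
  by rewrite invE.
(* [z] is the derivative of [w] along its own flow. As [k1 w = 1], it satisfies [k1 z = w1], which
   links it to the derivative of the field. *)
pose z x := w1 x * w x.
have zL x y : `|z x - z y| <= M * (M * `|x - y|) + M * (M * `|x - y|).
  rewrite /z (_ : _ - _ = w1 x * (w x - w y) + w y * (w1 x - w1 y)); last by ring.
  by apply: norm_addW; apply: norm_mulW.
have zM x : `|z x| <= M * M by exact: norm_mulW.
(* [eta] is the relative precision with which a rotation [s] of [H] replaces [e]. In the derivative
   estimate the two errors are 16 M^3 e^2 and 2 eta M^2 |e|; this choice and the bound 32 M^3 below
   make each at most d |e| / 2. *)
pose eta := Num.min 1 (d / (4 * M ^+ 2)).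
have M2 : 0 < 4 * M ^+ 2 by rewrite mulr_gt0// exprn_gt0.
have M3 : 0 < 32 * M ^+ 3 by rewrite mulr_gt0// exprn_gt0.
have eta0 : 0 < eta by rewrite lt_min ltr01 divr_gt0.
have eta1 : eta <= 1 by rewrite ge_min lexx.
have etad : eta * (4 * M ^+ 2) <= d.
  by rewrite -ler_pdivlMr// ge_min lexx orbT.
exists (d / (32 * M ^+ 3)); first exact: divr_gt0.
move=> e /ltW; rewrite ler_pdivlMr//.
have [s s_in se] : exists2 s, rotation_in H s & `|s - e| <= eta * `|e|.
  have [->|eN0] := eqVneq e 0.
    exists 0; last by rewrite subrr normr0 mulr0.
    by have := lift_in_tau Hgrp 0; rewrite mulr0z.
  by apply: rotation_in_dense => //; rewrite mulr_gt0// normr_gt0.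
have := lift_in_comp Hgrp (lift_in_comp Hgrp J_in s_in) k_in.
set P := (X in lift_in _ X); set P1 := (X in lift_in _ _ X) => P_in.
have [D DE] : exists D, D = `|e| by exists `|e|.
rewrite -!DE in se * => DM.
have D0 : 0 <= D by rewrite DE.
exists P, P1; split=> // x.
(* The orbit of [x] under the flow of [w]: the conjugated rotations are exactly this flow, so A' =
   w(A). Both estimates are mean values in time along it. *)
pose A t := J (t + k x).
have dA (t : R) : is_derive t 1 A (w (A t)) by exact: is_derive_translate.
have dB (t : R) : is_derive t 1 (w \o A) (z (A t)) by exact: is_derive1_comp.
have A0 : A 0 = x by rewrite /A add0r kJ.
have AL t : `|A t - x| <= M * `|t|.
  rewrite -[x in X in X <= _]A0 -[t in X in _ <= X]subr0.
  exact: lipschitz_of_derive dA _ _ _.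
have s2D : `|s| <= 2 * D.
  rewrite (_ : s = s - e + e); last by ring.
  apply: le_trans (norm_addW se (lexx _)) _; rewrite -DE mulrDl mul1r.
  by rewrite lerD2r ler_piMl.
have Ac c : `|c - 0| <= `|s - 0| -> `|A c - x| <= M * (2 * D).
  rewrite !subr0 => cs; apply: le_trans (AL c) _.
  by rewrite ler_wpM2l ?(ltW M0)// (le_trans cs).
have kin : (k x + s) = (s + k x) by rewrite addrC.
have DD : D * (D * (32 * M ^+ 3)) <= D * d by rewrite ler_wpM2l.
have etaD : D * (eta * (4 * M ^+ 2)) <= D * d by rewrite ler_wpM2l.
split.
  have [c cs cE] := mean_value 0 s dA.
  rewrite (_ : _ - _ = (w (A c) - w x) * s + (s - e) * w x); last first.
    by move: cE; rewrite A0 subr0 /P /= kin -/(A s) mulrBl => <-; ring.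
  have wAc : `|w (A c) - w x| <= M * (M * (2 * D)).
    by apply: le_trans (wL _ _) _; rewrite ler_wpM2l ?(ltW M0)// Ac.
  apply: le_trans (norm_addW (norm_mulW wAc s2D) (norm_mulW se (wM x))) _.
  have h1 : D * (D * M ^+ 2) <= D * (D * M ^+ 3).
    by do 2 apply: ler_wpM2l => //; exact: ler_weXn2l.
  have h2 : D * (eta * M) <= D * (eta * M ^+ 2).
    apply: ler_wpM2l => //; apply: ler_wpM2l; first exact: ltW.
    by rewrite expr2 ler_peMr// ltW.
  have h3 : 0 <= D * (D * M ^+ 3) by rewrite !mulr_ge0// ltW.
  have h4 : 0 <= D * (eta * M ^+ 2) by rewrite !mulr_ge0// ltW.
  by clear -DD etaD h1 h2 h3 h4; lra.
have [c cs cE] := mean_value 0 s dB.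
have P1E : P1 x = w (A s) * k1 x by rewrite /P1 /= mulr1 kin invE.
rewrite (_ : _ - _ = k1 x * ((z (A c) - z x) * s + (s - e) * z x)); last first.
  move: cE; rewrite /= A0 subr0 => zE.
  rewrite (_ : _ * s + _ = z (A c) * s - e * z x); last by ring.
  have kz : k1 x * z x = w1 x by rewrite /z mulrCA kw mulr1.
  by rewrite -zE P1E -kz -(kw x); ring.
have zAc : `|z (A c) - z x| <= M * (M * (M * (2 * D))) + M * (M * (M * (2 * D))).
  by apply: le_trans (zL _ _) _; apply: lerD; rewrite !ler_wpM2l ?(ltW M0)// Ac.
apply: le_trans (norm_mulW (k12 x)
  (norm_addW (norm_mulW zAc s2D) (norm_mulW se (zM x)))) _.
by clear -DD etaD; lra.
Qed.

End AdjointOfRotations.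

(** * The Poisson kernel and sums over equally spaced nodes *)

Section PoissonKernel.
Context {R : realType}.
Implicit Types (r t a e : R) (k m n M N : nat).

Definition node N (j : nat) : R := tau * j%:R / N%:R.

(** Multiplying by 2 sin b, with [b] half the angular step, makes the sum telescope over a whole
    number of periods; 0 < m < N keeps [b] inside (0, pi), so sin b is nonzero. *)
Lemma sum_cos_nodes N m a : (0 < m < N)%N ->
  \sum_(j < N) cos (a + m%:R * node N j) = 0.
Proof.
move=> /andP[m0 mN].
have N0 : N%:R != 0 :> R by rewrite pnatr_eq0; lia.
have N_gt0 : 0 < N%:R :> R by rewrite ltr0n; lia.
pose b : R := pi * m%:R / N%:R.
have sin_b : sin b != 0.
  rewrite gt_eqF// sin_gt0_pi// /b; apply/andP; split.
    by rewrite divr_gt0// mulr_gt0 ?pi_gt0// ltr0n.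
  by rewrite ltr_pdivrMr// ltr_pM2l ?pi_gt0// ltr_nat.
pose g j : R := sin (a + m%:R * node N j - b).
have gS j : 2 * sin b * cos (a + m%:R * node N j) = g j.+1 - g j.
  have -> : g j.+1 = sin (a + m%:R * node N j + b).
    rewrite /g; congr sin; rewrite /node /b -natr1 mulr2n; field.
    exact: N0.
  by rewrite /g sinB sinD; ring.
have : 2 * sin b * \sum_(j < N) cos (a + m%:R * node N j) = 0.
  rewrite mulr_sumr (eq_bigr _ (fun (j : 'I_N) _ => gS j)).
  rewrite -(big_mkord xpredT (fun j => g j.+1 - g j)) telescope_sumr//.
  apply/eqP; rewrite subr_eq0; apply/eqP.
  rewrite /g /node mulr0 mul0r mulr0 addr0 mulfK// mulrC.
  rewrite addrAC mulr_natr -(periodic_int (@sinD2pi R) m (a - b)).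
  by congr sin; rewrite -pmulrn.
by move=> /eqP; rewrite mulf_eq0 mulf_eq0 pnatr_eq0/= (negPf sin_b) => /eqP.
Qed.

Lemma sum_cos_nodes_rev N k t : (0 < k < N)%N ->
  \sum_(j < N) cos (k%:R * (t - node N j)) = 0.
Proof.
move=> kN; rewrite -[RHS](sum_cos_nodes (- (k%:R * t)) kN).
by apply: eq_bigr => j _; rewrite -cosN; congr cos; ring.
Qed.

(** Discrete orthogonality by product-to-sum. The bound k + n < N excludes aliasing, so only the
    difference frequency 0 survives. *)
Lemma sum_cos_cos_nodes N n k t : (0 < n)%N -> (0 < k)%N -> (k + n < N)%N ->
  \sum_(j < N) 2 * (cos (n%:R * node N j) * cos (k%:R * (t - node N j))) =
  if k == n then N%:R * cos (n%:R * t) else 0.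
Proof.
move=> n0 k0 knN.
transitivity (\sum_(j < N) cos (- (k%:R * t) + (k + n)%:R * node N j) +
    \sum_(j < N) cos (k%:R * t + (n%:R - k%:R) * node N j)).
  rewrite -big_split; apply: eq_bigr => j _ /=.
  set A := n%:R * node N j; set B := k%:R * (t - node N j).
  rewrite (_ : - (k%:R * t) + _ = A - B); last by rewrite /A /B natrD; ring.
  rewrite (_ : k%:R * t + _ = A + B); last by rewrite /A /B; ring.
  by rewrite cosB cosD; ring.
rewrite sum_cos_nodes ?add0r; last by rewrite addn_gt0 k0 knN.
have [kn|nk|<-] := ltngtP k n.
- rewrite -[RHS](@sum_cos_nodes N (n - k) (k%:R * t)); last lia.
  by apply: eq_bigr => j _; rewrite natrB// ltnW.
- rewrite -[RHS](@sum_cos_nodes N (k - n) (- (k%:R * t))); last lia.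
  apply: eq_bigr => j _; rewrite -cosN natrB; last exact: ltnW.
  by congr cos; ring.
- rewrite (eq_bigr (fun=> cos (k%:R * t))); last first.
    by move=> j _; rewrite subrr mul0r addr0.
  by rewrite sumr_const card_ord [RHS]mulr_natl.
Qed.

Definition poisson_sum r M t : R :=
  1 + 2 * \sum_(k < M) r ^+ k.+1 * cos (k.+1%:R * t).

Lemma poisson_sum_nodes r M N t : (M < N)%N ->
  \sum_(j < N) poisson_sum r M (t - node N j) = N%:R.
Proof.
move=> MN; rewrite big_split /= sumr_const card_ord -mulr_sumr exchange_big/=.
rewrite big1 ?mulr0 ?addr0// => k _; rewrite -mulr_sumr sum_cos_nodes_rev ?mulr0//.
by have := ltn_ord k; lia.
Qed.

Lemma poisson_sum_mode r M N n t : (0 < n <= M)%N -> (M + n < N)%N ->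
  \sum_(j < N) cos (n%:R * node N j) * poisson_sum r M (t - node N j) =
  N%:R * r ^+ n * cos (n%:R * t).
Proof.
move=> /andP[n0 nM] MnN.
transitivity (\sum_(j < N) cos (0 + n%:R * node N j) + \sum_(k < M) r ^+ k.+1 *
  \sum_(j < N) 2 * (cos (n%:R * node N j) * cos (k.+1%:R * (t - node N j)))).
  under [in RHS]eq_bigr do rewrite add0r.
  under [X in _ = _ + X]eq_bigr do rewrite mulr_sumr.
  rewrite exchange_big -big_split; apply: eq_bigr => j _ /=.
  rewrite /poisson_sum mulrDr mulr1 mulrCA !mulr_sumr; congr (_ + _).
  by apply: eq_bigr => k _; ring.
rewrite sum_cos_nodes ?add0r; last lia.
rewrite (eq_bigr (fun k : 'I_M =>
  if k.+1 == n then N%:R * r ^+ n * cos (n%:R * t) else 0)); last first.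
  move=> k _; rewrite sum_cos_cos_nodes//; last by have := ltn_ord k; lia.
  by case: eqP => [->|_]; [ring|rewrite mulr0].
have nM' : (n.-1 < M)%N by lia.
rewrite (bigD1 (Ordinal nM'))//= prednK// eqxx big1 ?addr0// => k.
by rewrite -val_eqE/=; case: (k.+1 =P n) => // <-; rewrite eqxx.
Qed.

(** This is |1 - r e^{it}|^2. *)
Definition poisson_den r t : R := 1 - 2 * r * cos t + r ^+ 2.

Lemma poisson_den_ge r t : 0 <= r -> (1 - r) ^+ 2 <= poisson_den r t.
Proof.
move=> r0; rewrite -subr_ge0 (_ : _ - _ = 2 * r * (1 - cos t)).
  by rewrite !mulr_ge0// subr_ge0 cos_le1.
by rewrite /poisson_den; ring.
Qed.

Lemma poisson_den_gt0 r t : 0 <= r < 1 -> 0 < poisson_den r t.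
Proof.
move=> /andP[r0 r1]; apply: lt_le_trans (poisson_den_ge t r0).
by rewrite exprn_gt0// subr_gt0.
Qed.

(** The real form of the finite geometric sum in r e^{it}: only boundary terms at 0 and at the top
    index remain. *)
Lemma poisson_sum_den r M t : poisson_den r t * poisson_sum r M t =
  1 - r ^+ 2 + 2 * r ^+ M.+1 * (r * cos (M%:R * t) - cos (M.+1%:R * t)).
Proof.
elim: M => [|M IH].
  rewrite /poisson_sum big_ord0 /poisson_den mul0r cos0 mul1r; ring.
have -> : poisson_sum r M.+1 t =
    poisson_sum r M t + 2 * (r ^+ M.+1 * cos (M.+1%:R * t)).
  by rewrite /poisson_sum big_ord_recr/=; ring.
rewrite mulrDr IH.
have -> : cos (M%:R * t) = cos (M.+1%:R * t) * cos t + sin (M.+1%:R * t) * sin t.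
  by rewrite -cosB; congr cos; rewrite -natr1; ring.
have -> : cos (M.+2%:R * t) = cos (M.+1%:R * t) * cos t - sin (M.+1%:R * t) * sin t.
  by rewrite -cosD; congr cos; rewrite -[M.+2%:R]natr1; ring.
by rewrite /poisson_den !exprS; ring.
Qed.

Definition poisson r t : R := (1 - r ^+ 2) / poisson_den r t.

Definition poisson_tail r M t : R :=
  2 * r ^+ M.+1 * (r * cos (M%:R * t) - cos (M.+1%:R * t)).

Lemma poisson_sumE r M t : 0 <= r < 1 ->
  poisson_sum r M t = poisson r t + poisson_tail r M t / poisson_den r t.
Proof.
move=> r01; have d0 : poisson_den r t != 0 by rewrite gt_eqF// poisson_den_gt0.
by rewrite /poisson -mulrDl -poisson_sum_den mulrAC mulfV// mul1r.
Qed.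

Lemma poisson_tail_bound r M t : 0 <= r <= 1 ->
  `|poisson_tail r M t| <= 4 * r ^+ M.+1.
Proof.
move=> /andP[r0 r1].
have rM0 : 0 <= 2 * r ^+ M.+1 by rewrite mulr_ge0// exprn_ge0.
have : `|r * cos (M%:R * t) - cos (M.+1%:R * t)| <= 1 * 1 + 1.
  apply: norm_addW; last by rewrite normrN cos_max.
  by apply: norm_mulW; rewrite ?cos_max// ger0_norm.
move=> h; rewrite /poisson_tail normrM (ger0_norm rM0).
have := ler_wpM2l rM0 h; lra.
Qed.

Lemma poisson_ge0 r t : 0 <= r < 1 -> 0 <= poisson r t.
Proof.
move=> /[dup] r01 /andP[r0 r1]; rewrite divr_ge0 ?(ltW (poisson_den_gt0 _ _))//.
by rewrite subr_ge0 expr_le1// ltW.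
Qed.

Lemma poisson_sum_near r M t : 0 <= r < 1 ->
  `|poisson_sum r M t - poisson r t| <= 4 * r ^+ M.+1 / (1 - r) ^+ 2.
Proof.
move=> /[dup] r01 /andP[r0 r1].
rewrite poisson_sumE// addrAC subrr add0r normrM normfV.
have d0 : 0 < poisson_den r t := poisson_den_gt0 t r01.
have r10 : 0 < (1 - r) ^+ 2 by rewrite exprn_gt0// subr_gt0.
apply: ler_pM => //.
  by apply: poisson_tail_bound; rewrite r0 ltW.
by rewrite (gtr0_norm d0) lef_pV2// poisson_den_ge.
Qed.

(** The approximate-identity property in pointwise form: the weight 1 - cos t cancels the peak,
    since the denominator is (1 - r)^2 + 2 r (1 - cos t). *)
Lemma poisson_concentrated r t : 1 / 2 <= r < 1 ->
  (1 - cos t) * poisson r t <= 2 * (1 - r).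
Proof.
move=> /andP[r12 r1]; have r0 : 0 <= r by lra.
have d0 : 0 < poisson_den r t by rewrite poisson_den_gt0// r0.
rewrite /poisson mulrA ler_pdivrMr//.
have c0 : 0 <= 1 - cos t by rewrite subr_ge0 cos_le1.
have -> : poisson_den r t = (1 - r) ^+ 2 + 2 * r * (1 - cos t).
  by rewrite /poisson_den; ring.
rewrite -subr_ge0 (_ : _ - _ = (1 - r) * (2 * (1 - r) ^+ 2
  + (1 - cos t) * (3 * r - 1))); last by ring.
rewrite mulr_ge0 ?subr_ge0 ?(ltW r1)// addr_ge0//.
  by rewrite mulr_ge0// exprn_ge0// subr_ge0 ltW.
by rewrite mulr_ge0//; lra.
Qed.

Lemma exprn_small r e : 0 <= r < 1 -> 0 < e -> exists M0 : nat,
  forall M, (M0 <= M)%N -> r ^+ M <= e.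
Proof.
move=> /andP[r0 r1] e0.
have /cvg_expr : `|r| < 1 by rewrite ger0_norm.
move=> /cvgr_norm_lt; rewrite normr0 => /(_ _ e0)[M0 _ hM]; exists M0 => M MM.
by have := hM M MM; rewrite /= ger0_norm ?exprn_ge0// => /ltW.
Qed.

End PoissonKernel.

(** * Trigonometric modes in the Lie algebra *)

Section TangentTrigonometric.
Context {R : realType}.
Variable H : set (diff1p R).
Hypothesis Hgrp : subgroup H.
Hypothesis Hrot : rotation_in H (tau * Num.sqrt 2).
Implicit Types (x y t r d e K a : R) (k n m M N : nat).

Lemma tangent_comb n (c : 'I_n -> R) (u u1 : 'I_n -> R -> R) :
  (forall i, tangent H (u i) (u1 i)) ->
  tangent H (fun x => \sum_(i < n) c i * u i x)
            (fun x => \sum_(i < n) c i * u1 i x).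
Proof.
move=> ut; apply: (tangent_sum Hgrp (u := fun i x => c i * u i x)
  (u1 := fun i x => c i * u1 i x)) => i.
exact: tangentZ.
Qed.

Lemma norm_sum_bound n (f : 'I_n -> R) (b : R) : (forall i, `|f i| <= b) ->
  `|\sum_(i < n) f i| <= n%:R * b.
Proof.
move=> fb; apply: le_trans (ler_norm_sum _ _ _) _.
apply: le_trans (ler_sum _ (fun i _ => fb i)) _.
by rewrite sumr_const card_ord mulr_natl.
Qed.

Lemma is_derive_scale a x : is_derive x 1 ( *%R a) a.
Proof.
rewrite -[X in is_derive _ _ _ X]mulr1.
exact: (@is_deriveZ _ _ _ id a x 1 1).
Qed.

Lemma is_derive_cos_scale a x :
  is_derive x 1 (fun t => cos (a * t)) (- (a * sin (a * x))).
Proof.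
have := is_derive1_comp (is_derive_cos (a * x)) (is_derive_scale a x).
by rewrite mulNr mulrC.
Qed.

Lemma C11_cos n : C11 (1 + n%:R + n%:R ^+ 2 : R)
  (fun x => cos (n%:R * x)) (fun x => - (n%:R * sin (n%:R * x))).
Proof.
have n0 : 0 <= n%:R :> R by rewrite ler0n.
have n20 : 0 <= n%:R ^+ 2 :> R by rewrite exprn_ge0.
split=> [x|x|x|x y]; first exact: is_derive_cos_scale.
- by apply: le_trans (cos_max _) _; rewrite -addrA lerDl addr_ge0.
- rewrite normrN; apply: le_trans (norm_mulW (lexx _) (sin_max _)) _.
  by rewrite mulr1 ger0_norm//; lra.
- have := @lipschitz_of_derive R sin cos 1 (@is_derive_sin R) (@cos_max R)
    (n%:R * x) (n%:R * y).
  rewrite mul1r -mulrBr normrM (ger0_norm n0) => sL.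
  rewrite -opprB normrN opprK addrC -mulrBr normrM (ger0_norm n0).
  apply: le_trans (ler_wpM2l n0 sL) _.
  rewrite mulrA -expr2 ler_wpM2r//; lra.
Qed.

Section Modes.
Hypothesis Hk : lift_in H (fun x => x - 4 / 5 * sin x)
  (fun x => 1 - 4 / 5 * cos x).

Let w (x : R) := (1 - 4 / 5 * cos x)^-1.
Let w1 (x : R) := - (4 / 5 * sin x * w x ^+ 2).

Lemma w_den x : 1 / 5 <= 1 - 4 / 5 * cos x.
Proof. by have := cos_le1 x; lra. Qed.

Lemma w_bound x : 0 < w x <= 5.
Proof.
have h := w_den x; rewrite /w invr_gt0 (lt_le_trans _ h)//=.
by rewrite -[leRHS]invrK lef_pV2 ?posrE ?invr_gt0//; lra.
Qed.

Lemma C11_w : C11 200 w w1.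
Proof.
have w0 x : 0 <= w x by rewrite ltW//; case/andP: (w_bound x).
have wM x : `|w x| <= 5 by rewrite ger0_norm//; case/andP: (w_bound x).
have w2M x : `|w x ^+ 2| <= 5 * 5 by rewrite expr2; exact: norm_mulW.
have c45 : `|4 / 5 : R| <= 4 / 5 by rewrite ger0_norm.
have w1M x : `|w1 x| <= 4 / 5 * 1 * (5 * 5).
  by rewrite normrN; do 2 apply: norm_mulW => //; exact: sin_max.
have dw x : is_derive x 1 w (w1 x).
  have d : is_derive x 1 (cst 1 - (4 / 5) *: cos) (0 - (4 / 5) *: (- sin x)).
    exact: is_deriveB.
  have dN0 : (cst 1 - (4 / 5) *: cos) x != 0 :> R.
    by rewrite gt_eqF//; apply: lt_le_trans (w_den x).
  apply: is_derive_eq (is_deriveV dN0 d) _.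
  rewrite /w1 /w !fctE /= /GRing.scale /= -exprVn; ring.
split=> // [x|x|x y].
- by apply: le_trans (wM x) _; lra.
- by apply: le_trans (w1M x) _; lra.
- have wL : `|w x - w y| <= 4 / 5 * 1 * (5 * 5) * `|x - y|.
    exact: lipschitz_of_derive dw w1M x y.
  have sL : `|sin x - sin y| <= 1 * `|x - y|.
    exact: lipschitz_of_derive (@is_derive_sin R) (@cos_max R) x y.
  have wwM : `|w x + w y| <= 5 + 5 by exact: norm_addW.
  rewrite (_ : _ - _ = - (4 / 5 * (sin x * ((w x + w y) * (w x - w y))
    + (sin x - sin y) * w y ^+ 2))); last by rewrite /w1; ring.
  rewrite normrN; apply: le_trans (norm_mulW c45 (norm_addW (norm_mulW
    (sin_max x) (norm_mulW wwM wL)) (norm_mulW sL (w2M y)))) _.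
  have := normr_ge0 (x - y); set D := `|_| => D0; lra.
Qed.

Lemma tangent_w : tangent H w w1.
Proof.
apply: tangent_adjoint Hk C11_w _ _ => // x.
  by rewrite mulfV// gt_eqF// (lt_le_trans _ (w_den x)).
apply: le_trans (ler_normB _ _) _; rewrite normr1.
have : `|4 / 5 * cos x| <= 1 * 1.
  by apply: norm_mulW; [rewrite ger0_norm; lra|exact: cos_max].
by lra.
Qed.

(** Here the generator is matched with the kernel: at r = 1/2 the denominator is 5/4 - cos x, a
    multiple of the derivative 1 - (4/5) cos x. *)
Lemma poisson_den_w x : (poisson_den (1 / 2) x)^-1 = 4 / 5 * w x.
Proof.
rewrite (_ : poisson_den _ _ = 5 / 4 * (1 - 4 / 5 * cos x)).
  by rewrite invfM -/(w x); congr (_ * _); lra.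
by rewrite /poisson_den; field.
Qed.

Lemma poisson_w x : poisson (1 / 2) x = 3 / 5 * w x.
Proof. by rewrite /poisson poisson_den_w; field. Qed.

Let E M x := poisson_tail (1 / 2) M x * (4 / 5 * w x).

(** Differentiating the tail brings down a factor of order [M], against which (1/2)^M still wins;
    the factor [w] contributes only constants, collected in 80. *)
Lemma E_bound M : exists E1 : R -> R, [/\ forall x, is_derive x 1 (E M) (E1 x),
  forall x, `|E M x| <= 80 * (M.+1%:R * (1 / 2) ^+ M.+1) &
  forall x, `|E1 x| <= 80 * (M.+1%:R * (1 / 2) ^+ M.+1)].
Proof.
have [dw wM' w1M' _] := C11_w.
have wM x : `|4 / 5 * w x| <= 4 / 5 * 5.
  apply: norm_mulW; first by rewrite ger0_norm; lra.
  by case/andP: (w_bound x) => *; rewrite ger0_norm// ltW.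
have w1M x : `|4 / 5 * w1 x| <= 4 / 5 * (4 / 5 * 1 * (5 * 5)).
  apply: norm_mulW; first by rewrite ger0_norm; lra.
  rewrite normrN; apply: norm_mulW.
    by apply: norm_mulW; [rewrite ger0_norm; lra|exact: sin_max].
  by case/andP: (w_bound x) => *; rewrite expr2; apply: norm_mulW;
    rewrite ger0_norm// ltW.
set q : R := (1 / 2) ^+ M.+1.
have q0 : 0 <= q by rewrite exprn_ge0.
have TM x : `|poisson_tail (1 / 2) M x| <= 4 * q by apply: poisson_tail_bound; lra.
have M0 : 0 <= M%:R :> R by rewrite ler0n.
have M1 : M.+1%:R = M%:R + 1 :> R by rewrite natr1.
pose T1 x := 2 * q * (1 / 2 * (- (M%:R * sin (M%:R * x)))
  - - (M.+1%:R * sin (M.+1%:R * x))).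
have dT x : is_derive x 1 (poisson_tail (1 / 2) M) (T1 x).
  have d : is_derive x 1 ((2 * q) *: ((1 / 2) *: (fun t => cos (M%:R * t)) -
      (fun t => cos (M.+1%:R * t)))) (T1 x).
    apply: is_deriveZ; apply: is_deriveB; last exact: is_derive_cos_scale.
    by apply: is_deriveZ; exact: is_derive_cos_scale.
  exact: d.
have T1M x : `|T1 x| <= 2 * q * (1 / 2 * (M%:R * 1) + M.+1%:R * 1).
  apply: norm_mulW; first by rewrite ger0_norm ?mulr_ge0.
  apply: norm_addW.
    apply: norm_mulW; first by rewrite ger0_norm; lra.
    by rewrite normrN; apply: norm_mulW; [rewrite ger0_norm|exact: sin_max].
  rewrite opprK; apply: norm_mulW; last exact: sin_max.
  by rewrite ger0_norm.
have Mq0 : 0 <= M%:R * q by rewrite mulr_ge0.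
exists (fun x => poisson_tail (1 / 2) M x * (4 / 5 * w1 x) + 4 / 5 * w x * T1 x).
split=> x.
- have dv : is_derive x 1 ((4 / 5) *: w) (4 / 5 * w1 x) by exact: is_deriveZ.
  exact: is_deriveM (dT x) dv.
- apply: le_trans (norm_mulW (TM x) (wM x)) _; rewrite M1; lra.
- apply: le_trans (norm_addW (norm_mulW (TM x) (w1M x))
    (norm_mulW (wM x) (T1M x))) _.
  by rewrite M1; lra.
Qed.

Lemma linear_times_geometric_small e n : 0 < e ->
  exists2 M, (n <= M)%N & M.+1%:R * (1 / 2) ^+ M.+1 <= e.
Proof.
move=> e0; have r12 : 0 <= (1 / 2 : R) < 1 by lra.
have [M0 hM0] := exprn_small r12 (divr_gt0 e0 (ltr0n R 2)).
(* With M + 1 = 2 q the geometric factor splits in two halves: one absorbs [q], the other is at most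
   e / 2. *)
pose q := (maxn M0 n).+1; exists (q.*2).-1; first by rewrite /q; lia.
rewrite prednK; last by rewrite /q; lia.
have qM : (1 / 2) ^+ q <= e / 2 by apply: hM0; rewrite /q; lia.
rewrite -addnn exprD natrD.
have Q0 : 0 <= (1 / 2) ^+ q :> R by rewrite exprn_ge0.
have : q%:R * (1 / 2) ^+ q <= 1 :> R.
  rewrite div1r exprVn ler_pdivrMr ?exprn_gt0// mul1r -natrX ler_nat.
  exact/ltnW/ltn_expl.
by set Q := _ ^+ q in Q0 qM *; move=> qQ; nra.
Qed.

(* Averaging translates of the Poisson kernel against [cos (n x)] at equally
   spaced nodes isolates its [n]-th Fourier mode. *)
Lemma tangent_cos n : (0 < n)%N ->
  tangent H (fun x => cos (n%:R * x)) (fun x => - (n%:R * sin (n%:R * x))).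
Proof.
move=> n0; apply: tangent_lim (C11_cos n) _ => d d0.
pose rn : R := (1 / 2) ^+ n; have rn0 : 0 < rn by rewrite exprn_gt0.
have [M nM MB] := linear_times_geometric_small n
  (divr_gt0 (mulr_gt0 d0 rn0) (ltr0n R 80)).
have [E1 [dE EB E1B]] := E_bound M.
(* The least number of nodes without aliasing. The weights divide by the factor N r^n that the node
   sum puts before [cos (n x)]; as [3/5 * w] is the full kernel, [U] misses this mode only by tails
   [E M]. *)
pose N := (M + n).+1; have N0 : 0 < N%:R :> R by rewrite ltr0n.
pose c (j : 'I_N) := (N%:R * rn)^-1 * cos (n%:R * node N j).
have cB j : `|c j| <= (N%:R * rn)^-1 * 1.
  by apply: norm_mulW; [rewrite ger0_norm// invr_ge0 mulr_ge0// ltW|exact: cos_max].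
pose U x := \sum_(j < N) c j * (3 / 5 * w (x - node N j)).
pose U1 x := \sum_(j < N) c j * (3 / 5 * w1 (x - node N j)).
have Ut : tangent H U U1.
  apply: tangent_comb => j.
  exact: (tangent_translate Hgrp Hrot (- node N j) (tangentZ (3 / 5) tangent_w)).
have [[KU [dU _ _ _]] _] := Ut.
exists U, U1; split=> //.
have UE x : cos (n%:R * x) - U x = \sum_(j < N) c j * E M (x - node N j).
  have -> : cos (n%:R * x) = \sum_(j < N) c j * poisson_sum (1 / 2) M (x - node N j).
    have := @poisson_sum_mode R (1 / 2) M N n x; rewrite n0 nM => /(_ isT (ltnSn _)).
    rewrite -/rn => sE.
    under eq_bigr do rewrite -mulrA.
    by rewrite -mulr_sumr sE mulKf// mulf_neq0// gt_eqF.
  rewrite -sumrB; apply: eq_bigr => j _.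
  rewrite poisson_sumE; last lra.
  by rewrite poisson_w poisson_den_w /E; ring.
have bound (g : R -> R) x : (forall y, `|g y| <= 80 * (M.+1%:R * (1 / 2) ^+ M.+1)) ->
    `|\sum_(j < N) c j * g (x - node N j)| <= d.
  move=> gB; apply: le_trans (norm_sum_bound (fun j => norm_mulW (cB j) (gB _))) _.
  rewrite mulr1 invfM -!mulrA mulVKf ?gt_eqF//.
  by rewrite mulrC ler_pdivrMr// mulrC -ler_pdivlMr.
move=> x; split; rewrite distrC; first by rewrite UE; exact: bound.
(* The error of [U1] comes from differentiating both sides of the identity [UE]. *)
have dcU : is_derive x 1 ((fun t => cos (n%:R * t)) - U)
    (- (n%:R * sin (n%:R * x)) - U1 x).
  by apply: is_deriveB; exact: is_derive_cos_scale.
have dS : is_derive x 1 (\sum_(j < N) (c j *: (fun t => E M (t - node N j))))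
    (\sum_(j < N) c j *: E1 (x - node N j)).
  apply: is_derive_sum => j; apply: is_deriveZ; exact: is_derive_translate.
have -> : - (n%:R * sin (n%:R * x)) - U1 x = \sum_(j < N) c j * E1 (x - node N j).
  rewrite -(is_derive_derive1 dcU) -[RHS](is_derive_derive1 dS).
  by congr (derive1 _ _); apply/funext => t; rewrite fct_sumE; exact: UE.
exact: bound.
Qed.

Lemma tangent_sin n : (0 < n)%N ->
  tangent H (fun x => sin (n%:R * x)) (fun x => n%:R * cos (n%:R * x)).
Proof.
move=> n0; have nN0 : n%:R != 0 :> R by rewrite pnatr_eq0 -lt0n.
have := tangent_translate Hgrp Hrot (- (pi / 2 / n%:R)) (tangent_cos n0).
have nE x : n%:R * (x - pi / 2 / n%:R) = n%:R * x - pi / 2.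
  by rewrite mulrBr mulrCA mulfV// mulr1.
rewrite (_ : (fun x => cos _) = (fun x => sin (n%:R * x))); last first.
  by apply/funext => x; rewrite nE cosBpihalf.
rewrite (_ : (fun x => - _) = (fun x => n%:R * cos (n%:R * x)))//.
by apply/funext => x; rewrite nE sinBpihalf mulrN opprK.
Qed.

End Modes.
End TangentTrigonometric.

(** * Every periodic C^{1,1} field is tangent *)

Section TangentPeriodic.
Context {R : realType}.
Variable H : set (diff1p R).
Hypothesis Hgrp : subgroup H.
Hypothesis Hrot : rotation_in H (tau * Num.sqrt 2).
Hypothesis Hsin : forall n, (0 < n)%N -> tangent H
  (fun x : R => sin (n%:R * x)) (fun x => n%:R * cos (n%:R * x)).
Implicit Types (x y t r d e K C a b : R) (k n m M N : nat).

(** A modulus of continuity shaped to pair with [poisson_concentrated]. At distance at most [b]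
    modulus [tau] the Lipschitz bound gives [e]; farther away 1 - cos is at least 1 - cos b and the
    crude bound 2 K suffices. *)
Lemma periodic_modulus (g : R -> R) K e : periodic g tau ->
  (forall x, `|g x| <= K) -> (forall x y, `|g x - g y| <= K * `|x - y|) ->
  0 < e -> exists2 C, 0 <= C &
    forall x y, `|g x - g y| <= e + C * (1 - cos (x - y)).
Proof.
move=> gP gK gL e0; have K0 : 0 <= K := le_trans (normr_ge0 _) (gK 0).
pose b := Num.min pi (e / (K + 1)).
have K10 : 0 < K + 1 by rewrite ltr_wpDl.
have b0 : 0 < b by rewrite lt_min pi_gt0 divr_gt0.
have bpi : b <= pi by rewrite ge_min lexx.
have be : K * b <= e.
  have : b <= e / (K + 1) by rewrite ge_min lexx orbT.
  rewrite ler_pdivlMr// mulrDr mulr1 mulrC; lra.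
have c0 : 0 < 1 - cos b.
  by rewrite subr_gt0 -cos0 ltr_cos ?in_itv/= ?lexx ?pi_ge0// ltW.
exists (2 * K / (1 - cos b)); first by rewrite divr_ge0 ?mulr_ge0// ltW.
move=> x y; have [m] := angle_representative (x - y).
rewrite -(periodic_int (@cosD2pi R) m (x - y)) -(periodic_int gP m x).
have -> : x - y + tau *~ m = x + tau *~ m - y by rewrite addrAC.
set z := x + tau *~ m => zpi.
have Cz : 0 <= 2 * K / (1 - cos b) * (1 - cos (z - y)).
  by rewrite mulr_ge0 ?divr_ge0 ?mulr_ge0 ?(ltW c0)// subr_ge0 cos_le1.
have [zb|bz] := leP `|z - y| b.
  rewrite -[leLHS]addr0 lerD//.
  by apply: le_trans (gL z y) _; apply: le_trans be; rewrite ler_wpM2l.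
have cz : cos (z - y) < cos b.
  by rewrite -cos_norm ltr_cos ?in_itv/= ?normr_ge0 ?zpi// ?(ltW b0).
rewrite -[leLHS]add0r lerD ?(ltW e0)//.
apply: le_trans (norm_addW (gK z) (_ : `|- g y| <= K)) _; first by rewrite normrN.
rewrite mulrAC ler_pdivlMr// (_ : K + K = 2 * K); last by ring.
by rewrite ler_wpM2l ?mulr_ge0//; lra.
Qed.

Lemma tangent_cst_scale a : tangent H (cst a) (cst 0).
Proof.
have := tangentZ a (tangent_cst Hgrp Hrot).
rewrite (_ : a *: cst 1 = cst a); last first.
  by apply/funext => x; rewrite !fctE /GRing.scale/= mulr1.
by rewrite (_ : (fun x => _) = cst 0)//; apply/funext => x; rewrite /= mulr0.
Qed.

(* Sampling [v1] against a partial sum of the Poisson kernel, and integrating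
   the resulting trigonometric polynomial. *)
Lemma tangent_periodic K (v v1 : R -> R) : C11 K v v1 ->
  periodic v tau -> periodic v1 tau -> tangent H v v1.
Proof.
move=> vC vP v1P; apply: (tangent_lim vC) => d d0.
have [dv vK v1K v1L] := vC; have K0 := C11_ge0 vC.
have pi0 := @pi_gt0 R.
pose e := d / (8 * (pi + 1)).
have p1 : 0 < 8 * (pi + 1 : R) by rewrite mulr_gt0// addr_gt0.
have e0 : 0 < e by rewrite divr_gt0.
have e_d : e * (8 * (pi + 1)) = d by rewrite divfK// gt_eqF.
have [C C0 vmod] := periodic_modulus v1P v1K v1L e0.
have C20 : 0 < 2 * C + 2 by rewrite ltr_wpDl// mulr_ge0.
pose q := Num.min (1 / 2) (e / (2 * C + 2)).
have q0 : 0 < q by rewrite lt_min !divr_gt0.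
have q2 : q <= 1 / 2 by rewrite ge_min lexx.
have qC : C * (2 * q) <= e.
  have : q <= e / (2 * C + 2) by rewrite ge_min lexx orbT.
  rewrite ler_pdivlMr//; lra.
pose r := 1 - q.
have r01 : 0 <= r < 1 by rewrite /r; apply/andP; split; lra.
have r12 : 1 / 2 <= r < 1 by rewrite /r; apply/andP; split; lra.
have K20 : 0 < 2 * K + 1 by rewrite ltr_wpDl// mulr_ge0.
pose mu := Num.min 1 (e / (2 * K + 1)).
have mu0 : 0 < mu by rewrite lt_min ltr01 divr_gt0.
have mu1 : mu <= 1 by rewrite ge_min lexx.
have muK : 2 * K * mu <= e.
  have : mu <= e / (2 * K + 1) by rewrite ge_min lexx orbT.
  rewrite ler_pdivlMr//; lra.
have qq0 : 0 < q ^+ 2 by rewrite exprn_gt0.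
have [M hM] := exprn_small r01 (divr_gt0 (mulr_gt0 mu0 qq0) (ltr0n R 4)).
have near x : `|poisson_sum r M x - poisson r x| <= mu.
  apply: le_trans (poisson_sum_near M x r01) _.
  rewrite (_ : 1 - r = q); last by rewrite /r; ring.
  rewrite ler_pdivrMr//; have := hM M.+1 (leqnSn M); lra.
pose N := M.+1; have N0 : 0 < N%:R :> R by rewrite ltr0n.
have NN : N%:R != 0 :> R by rewrite gt_eqF.
(* A periodic primitive of the truncated kernel minus its mean 1; dropping the mean is what makes a
   periodic primitive possible. *)
pose Q x := \sum_(k < M) 2 * r ^+ k.+1 / k.+1%:R * sin (k.+1%:R * x).
pose Q1 x := \sum_(k < M)
  2 * r ^+ k.+1 / k.+1%:R * (k.+1%:R * cos (k.+1%:R * x)).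
have Qt : tangent H Q Q1 by apply: (tangent_comb Hgrp) => k; exact: Hsin.
have Q1E x : Q1 x = poisson_sum r M x - 1.
  rewrite /poisson_sum addrAC subrr add0r mulr_sumr; apply: eq_bigr => k _.
  by field.
have QP : periodic Q tau.
  move=> x; apply: eq_bigr => k _; congr (_ * _).
  rewrite mulrDr [k.+1%:R * tau]mulr_natl.
  exact: (periodicn (@sinD2pi R)).
pose c (j : 'I_N) := N%:R^-1 * v1 (node N j).
pose S x := \sum_(j < N) c j * Q (x - node N j).
pose S1 x := \sum_(j < N) c j * Q1 (x - node N j).
have St : tangent H S S1.
  apply: (tangent_comb Hgrp) => j.
  exact: (tangent_translate Hgrp Hrot (- node N j) Qt).
have [[KS [dS _ _ _]] _] := St.
have SP : periodic S tau.
  by move=> x; apply: eq_bigr => j _; rewrite addrAC QP.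
pose a0 := \sum_(j < N) c j.
(* [S1 + a0] is the discrete convolution of [v1] with the truncated kernel, [a0] restoring the mean
   dropped from [Q1]. *)
have core x : `|S1 x + a0 - v1 x| <= 4 * e.
  have -> : S1 x + a0 - v1 x = N%:R^-1 * \sum_(j < N)
      (v1 (node N j) - v1 x) * poisson_sum r M (x - node N j).
    under [in RHS]eq_bigr do rewrite mulrBl.
    rewrite sumrB -[X in _ = _ * (_ - X)]mulr_sumr.
    rewrite (poisson_sum_nodes r x (ltnSn M)) mulrBr [v1 x * _]mulrC mulKf//.
    congr (_ - _); rewrite -big_split mulr_sumr; apply: eq_bigr => j _ /=.
    by rewrite Q1E /c; ring.
  rewrite normrM ger0_norm ?invr_ge0 ?(ltW N0)// mulrC ler_pdivrMr//.
  apply: le_trans (ler_norm_sum _ _ _) _.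
  (* The truncated kernel may be negative, so the estimate passes through the nonnegative full
     kernel at cost [mu], then returns to the truncated one, whose node sum is exactly [N]. *)
  have bj (j : 'I_N) :
      `|(v1 (node N j) - v1 x) * poisson_sum r M (x - node N j)| <=
      e * poisson_sum r M (x - node N j) + (e * mu + C * (2 * q) + 2 * K * mu).
    set y := x - node N j; set X := v1 _ - _.
    have P0 : 0 <= poisson r y by exact: poisson_ge0.
    have cP : (1 - cos y) * poisson r y <= 2 * q.
      by have := poisson_concentrated y r12; rewrite (_ : 1 - r = q) ?subKr.
    have XC : `|X| <= e + C * (1 - cos y).
      by rewrite /X distrC; exact: vmod.
    have XK : `|X| <= 2 * K.
      by rewrite mulr2n mulrDl mul1r; apply: norm_addW; rewrite ?normrN.
    have pP : poisson r y <= poisson_sum r M y + mu.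
      by have := near y; rewrite distrC => /(le_trans (ler_norm _)); lra.
    rewrite (_ : X * _ = X * poisson r y
      + X * (poisson_sum r M y - poisson r y)); last by ring.
    have XP : `|X * poisson r y| <= (e + C * (1 - cos y)) * poisson r y.
      by apply: norm_mulW => //; rewrite ger0_norm.
    apply: le_trans (norm_addW XP (norm_mulW XK (near y))) _.
    have h1 := ler_wpM2l (ltW e0) pP; have h2 := ler_wpM2l C0 cP.
    move: (poisson_sum _ _ _) (poisson _ _) (cos y) h1 h2 => p1' p2' p3'; lra.
  apply: le_trans (ler_sum _ (fun j _ => bj j)) _.
  rewrite big_split /= -mulr_sumr (poisson_sum_nodes r x (ltnSn M)).
  rewrite sumr_const card_ord -[X in _ + X]mulr_natl -/N.
  rewrite [e * N%:R]mulrC -mulrDr [leRHS]mulrC ler_wpM2l ?(ltW N0)//.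
  have : e * mu <= e * 1 by rewrite ler_wpM2l// ltW.
  lra.
have dg x : is_derive x 1 (v - S) (v1 x - S1 x) by exact: is_deriveB.
have gP : periodic (v - S) tau by move=> x; rewrite !fctE vP SP.
(* [v - S] is periodic, so its derivative vanishes somewhere; at that point the previous estimate
   reads as a bound on [a0]. *)
have a0e : `|a0| <= 4 * e.
  have [c0 _] := mean_value 0 tau dg.
  rewrite -[tau in LHS]add0r gP subrr subr0 => /esym/eqP.
  rewrite mulf_eq0 [tau == 0]gt_eqF ?tau_gt0// orbF subr_eq0 => /eqP cE.
  by have := core c0; rewrite cE addrAC subrr add0r.
have g1 x : `|v1 x - S1 x| <= 8 * e.
  rewrite (_ : v1 x - S1 x = - (S1 x + a0 - v1 x) + a0); last by ring.
  have := core x; rewrite -normrN => h.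
  by apply: le_trans (norm_addW h a0e) _; lra.
exists (S + cst (v 0 - S 0)), (fun x => S1 x + cst 0 x).
split; first by apply: (tangentD Hgrp) => //; exact: tangent_cst_scale.
move=> x; split; last first.
  by rewrite /= addr0 distrC; apply: le_trans (g1 x) _; rewrite -e_d; nra.
have [m xm] := angle_representative x.
rewrite (_ : _ - _ = - ((v - S) x - (v - S) 0)); last by rewrite !fctE; ring.
rewrite normrN -(periodic_int gP m x).
apply: le_trans (lipschitz_of_derive dg g1 _ _) _; rewrite subr0.
have : 8 * e * `|x + tau *~ m| <= 8 * e * pi by rewrite ler_wpM2l// mulr_ge0// ltW.
by move=> /le_trans; apply; rewrite -e_d; nra.
Qed.

End TangentPeriodic.

(** * Integrating tangent fields along a path of lifts *)

Section PathInduction.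
Context {R : realType}.
Implicit Types (x y s t e d K : R).

(** The supremum of the reachable times in [0, 1] is itself reachable and cannot be advanced. No
    lower bound on the step lengths is asked for. *)
Lemma real_induction (G : R -> Prop) : G 0 ->
  (forall t, 0 <= t <= 1 ->
     (forall e, 0 < e -> exists s, [/\ G s, 0 <= s <= t & t - e < s]) -> G t) ->
  (forall t, 0 <= t < 1 -> G t -> exists2 e, 0 < e & t + e <= 1 /\ G (t + e)) ->
  G 1.
Proof.
move=> G0 Glim Gstep; pose A := [set s | 0 <= s <= 1 /\ G s].
have A0 : A 0 by split=> //; rewrite lexx ler01.
have supA : has_sup A by split; [exists 0|exists 1 => s [/andP[]]].
pose t := sup A.
have At s : A s -> s <= t by move=> As; exact: sup_upper_bound.
have t0 : 0 <= t by exact: At.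
have t1 : t <= 1 by apply: ge_sup; [exists 0|move=> s [/andP[]]].
have Gt : G t.
  apply: Glim; first by rewrite t0.
  move=> e e0; have [s As ts] := sup_adherent e0 supA.
  have [/andP[s0 _] Gs] := As.
  by exists s; rewrite s0 At.
have [t_lt1|t_ge1] := ltP t 1; last by rewrite (le_anti (_ : 1 <= t <= 1)) ?t_ge1.
have [|e e0 [te1 Gte]] := Gstep t _ Gt; first by rewrite t0.
have : t + e <= t by apply: At; split=> //; rewrite te1 addr_ge0// ltW.
by rewrite gerDl leNgt e0.
Qed.

Lemma clift_derive_periodic (F F1 : R -> R) : clift F F1 -> periodic F1 tau.
Proof.
move=> [dF _ _ FP] x; have d : is_derive x 1 F (F1 (x + tau)).
  rewrite (_ : F = (fun y => F (y + tau)) + cst (- tau)); last first.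
    by apply/funext => y; rewrite !fctE FP addrK.
  rewrite -[X in is_derive _ _ _ X]addr0; apply: is_deriveD.
  exact: is_derive_translate.
by rewrite -(is_derive_derive1 d) (is_derive_derive1 (dF x)).
Qed.

Variable H : set (diff1p R).
Hypothesis Hgrp : subgroup H.
Hypothesis Htan : forall K (v v1 : R -> R), C11 K v v1 ->
  periodic v tau -> periodic v1 tau -> tangent H v v1.

Lemma C1_nearT e e' (F F1 G G1 P P1 : R -> R) : C1_near e F F1 G G1 ->
  C1_near e' G G1 P P1 -> C1_near (e + e') F F1 P P1.
Proof.
move=> FG GP x; have [fg fg1] := FG x; have [gp gp1] := GP x; split.
  by rewrite (_ : _ - _ = F x - G x + (G x - P x)); [exact: norm_addW|ring].
by rewrite (_ : _ - _ = F1 x - G1 x + (G1 x - P1 x)); [exact: norm_addW|ring].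
Qed.

Lemma C1_near_le e e' (F F1 G G1 : R -> R) : C1_near e F F1 G G1 -> e <= e' ->
  C1_near e' F F1 G G1.
Proof. by move=> FG ee' x; have [a b] := FG x; split; exact: le_trans ee'. Qed.

(** One step of a Gronwall argument. The new error d e is charged to the old error through [d <= E],
    so the total grows by a factor 1 + O(e). *)
Lemma flow_step (L K d : R) (v v1 : R -> R) : C11 L v v1 -> tangent H v v1 ->
  0 < d <= 1 -> 1 <= K -> exists2 e0, 0 < e0 &
  forall e, 0 <= e < e0 -> forall (E : R) (P P1 G G1 : R -> R), d <= E ->
    lift_in H P P1 -> C1_near E P P1 G G1 -> (forall x, `|G1 x| <= K) ->
    exists Q Q1, lift_in H Q Q1 /\
      C1_near (E * (1 + e * (L + 1 + K * L + K))) Q Q1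
        (fun x => G x + e * v (G x)) (fun x => G1 x + e * (v1 (G x) * G1 x)).
Proof.
move=> vC vt /andP[d0 d1] K1; have L0 := C11_ge0 vC.
have [_ hQ] := vt.
have [e0 e00 he] := hQ d d0; exists e0 => // e /andP[e_ge0 ee0].
move=> E P P1 G G1 dE Pin PG GK.
have [|Q [Q1 [Qin QC]]] := he e; first by rewrite ger0_norm.
exists (Q \o P), (fun x => Q1 (P x) * P1 x); split; first exact: lift_in_comp.
have [_ _ v1K v1L] := vC.
move: QC; rewrite ger0_norm// => QC x.
have [Qv Qd] := QC (P x); have [Pv Pd] := PG x; have GKx := GK x.
have E0 : 0 <= E by lra.
have ee : `|e| <= e by rewrite ger0_norm.
have eE : 0 <= e * E by exact: mulr_ge0.
have edE : e * d <= e * E by rewrite ler_wpM2l.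
have LeE : 0 <= L * (e * E) by exact: mulr_ge0.
have K0 : 0 <= K by lra.
have KeE : e * E <= K * (e * E) by rewrite ler_peMl.
have KLeE : L * (e * E) <= K * (L * (e * E)) by rewrite ler_peMl.
have edE' : K * (e * d) <= K * (e * E) by rewrite ler_wpM2l.
have vL : `|v (P x) - v (G x)| <= L * E.
  by apply: le_trans (C11_lipschitz vC _ _) _; rewrite ler_wpM2l.
have v1L' : `|v1 (P x) - v1 (G x)| <= L * E.
  by apply: le_trans (v1L _ _) _; rewrite ler_wpM2l.
split.
  rewrite (_ : _ - _ = Q (P x) - (P x + e * v (P x)) + (P x - G x)
    + e * (v (P x) - v (G x))); last by rewrite /=; ring.
  apply: le_trans (norm_addW (norm_addW Qv Pv) (norm_mulW ee vL)) _.
  lra.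
set a := Q1 (P x) - _ in Qd; set b := P1 x - _ in Pd.
rewrite (_ : _ - _ = b + b * (e * v1 (P x) + a)
  + G1 x * (e * (v1 (P x) - v1 (G x)) + a)); last by rewrite /a /b; ring.
apply: le_trans (norm_addW (norm_addW Pd (norm_mulW Pd (norm_addW
  (norm_mulW ee (v1K (P x))) Qd))) (norm_mulW GKx (norm_addW
  (norm_mulW ee v1L') Qd))) _.
have dE1 : E * (d * e) <= E * (1 * e) by do 2 rewrite ?ler_wpM2l ?ler_wpM2r//.
lra.
Qed.

Section Path.
Variables (F F1 : R -> R) (K : R).
Hypothesis FL : clift F F1.
Hypothesis F1K : forall x, `|F1 x| <= K.
Hypothesis F1L : forall x y, `|F1 x - F1 y| <= K * `|x - y|.

Definition path s x := x + s * (F x - x).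
Definition path1 s x := 1 + s * (F1 x - 1).

Lemma path_derive s x : is_derive x 1 (path s) (path1 s x).
Proof.
have [dF _ _ _] := FL.
have d : is_derive x 1 (id + s *: (F - id)) (1 + s *: (F1 x - 1)).
  by apply: is_deriveD; apply: is_deriveZ; exact: is_deriveB.
exact: d.
Qed.

Lemma path_lift s : 0 <= s <= 1 -> clift (path s) (path1 s).
Proof.
have [dF cF1 F10 FP] := FL.
move=> /andP[s0 s1]; split; first exact: path_derive.
- move=> x; apply: cvgD; first exact: cvg_cst.
  apply: cvgM; first exact: cvg_cst.
  by apply: cvgB; [exact: cF1|exact: cvg_cst].
- move=> x; rewrite /path1 (_ : _ + _ = (1 - s) + s * F1 x); last by ring.
  have [->|sN1] := eqVneq s 1; first by rewrite subrr add0r mul1r.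
  by rewrite ltr_wpDr ?mulr_ge0 ?(ltW (F10 x))// subr_gt0 lt_neqAle sN1.
- by move=> x; rewrite /path FP; ring.
Qed.

(* [path (s + e) = (id + e v) \o path s] with [v] bounded in C^{1,1} uniformly
   in [s]. *)
Lemma path_velocity : exists L, forall s, 0 <= s <= 1 -> exists v v1 : R -> R,
  [/\ C11 L v v1, periodic v tau, periodic v1 tau,
      forall x, v (path s x) = F x - x &
      forall x, v1 (path s x) * path1 s x = F1 x - 1].
Proof.
have [dF cF1 F10 FP] := FL; have F1P := clift_derive_periodic FL.
have K0 : 0 <= K := le_trans (normr_ge0 _) (F1K 0).
have phiP : periodic (fun x => F x - x) tau by move=> x; rewrite FP; ring.
have [B phiB] : exists B, forall x, `|F x - x| <= B.
  apply: periodic_bound phiP => x; apply: cvgB; last exact: cvg_id.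
  exact: is_derive_continuous dF x.
have B0 : 0 <= B := le_trans (normr_ge0 _) (phiB 0).
have [c c0 cF] := periodic_lower_bound cF1 F1P F10.
(* [path1 s] is a convex combination of 1 and [F1], so [m] bounds it below uniformly in [s]; this
   makes the constant [L] uniform. *)
pose m := Num.min 1 c; have m0 : 0 < m by rewrite lt_min ltr01.
have m1 : m <= 1 by rewrite ge_min lexx.
have mF x : m <= F1 x by rewrite (le_trans _ (cF x))// ge_min lexx orbT.
have mV0 : 0 <= m^-1 by rewrite invr_ge0 ltW.
exists (B + (K + 1) / m + K * (m^-1 * (m^-1 * m^-1))) => s s01.
have sL := path_lift s01; have [J [PJ JP JL]] := clift_inverse sL.
have [dJ _ J10 JE] := JL; have /andP[s0 s1] := s01.
have pathm x : m <= path1 s x.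
  rewrite /path1 -subr_ge0 (_ : _ - _ = (1 - s) * (1 - m) + s * (F1 x - m)).
    by rewrite addr_ge0 ?mulr_ge0 ?subr_ge0.
  by ring.
have path0 x : 0 < path1 s x := lt_le_trans m0 (pathm x).
have pathV x : `|(path1 s x)^-1| <= m^-1.
  by rewrite ger0_norm ?invr_ge0 ?(ltW (path0 x))// lef_pV2 ?posrE.
have psiK y : `|F1 (J y) - 1| <= K + 1.
  by apply: norm_addW; rewrite ?normrN ?normr1.
pose v := (fun x => F x - x) \o J.
pose v1 y := (F1 (J y) - 1) * (path1 s (J y))^-1.
have dphi x : is_derive x 1 (fun x => F x - x) (F1 x - 1) by exact: is_deriveB.
have T1 : 0 <= K * (m^-1 * (m^-1 * m^-1)) by rewrite !mulr_ge0.
have T2 : 0 <= (K + 1) / m by rewrite mulr_ge0// addr_ge0.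
exists v, v1; split.
- split=> [x|x|x|x y].
  + have := is_derive1_comp (dphi (J x)) (dJ x); exact.
  + by apply: le_trans (phiB _) _; rewrite -addrA lerDl addr_ge0.
  + by apply: le_trans (norm_mulW (psiK x) (pathV _)) _; lra.
  + have pN0 z : path1 s z != 0 by rewrite gt_eqF.
    (* With a and b the two values of [F1 - 1], a / (1 + s a) - b / (1 + s b) = (a - b) / ((1 + s a)
       (1 + s b)): the terms in s a b cancel. *)
    rewrite (_ : v1 x - v1 y = (F1 (J x) - F1 (J y)) *
      ((path1 s (J x))^-1 * (path1 s (J y))^-1)); last first.
      rewrite /v1; apply: (mulfI (mulf_neq0 (pN0 (J x)) (pN0 (J y)))).
      rewrite /path1; field.
      by rewrite !pN0.
    have JLip : `|J x - J y| <= m^-1 * `|x - y|.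
      exact: lipschitz_of_derive dJ (fun z => pathV (J z)) x y.
    have FJ : `|F1 (J x) - F1 (J y)| <= K * (m^-1 * `|x - y|).
      by apply: le_trans (F1L _ _) _; rewrite ler_wpM2l.
    apply: le_trans (norm_mulW FJ (norm_mulW (pathV _) (pathV _))) _.
    rewrite (_ : K * (m^-1 * `|x - y|) * (m^-1 / m) =
      K * (m^-1 * (m^-1 * m^-1)) * `|x - y|); last by ring.
    by rewrite ler_wpM2r// lerDr addr_ge0.
- by move=> y; rewrite /v /= JE phiP.
- by move=> y; rewrite /v1 JE F1P /path1 F1P.
- by move=> x; rewrite /v /= PJ.
- by move=> x; rewrite /v1 PJ divfK// gt_eqF.
Qed.

Lemma lift_approx d : 0 < d -> exists P P1,
  lift_in H P P1 /\ C1_near d P P1 F F1.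
Proof.
move=> d0; have [L hL] := path_velocity.
have [dF cF1 F10 FP] := FL; have F1P := clift_derive_periodic FL.
have K0 : 0 <= K := le_trans (normr_ge0 _) (F1K 0).
have L0 : 0 <= L.
  have [|v [v1 [vC _ _ _ _]]] := hL 0; first by rewrite lexx ler01.
  exact: C11_ge0 vC.
pose k := K + 1; have k1 : 1 <= k by rewrite /k lerDr.
have k0 : 0 <= k := le_trans ler01 k1.
pose C := L + 1 + k * L + k.
have C0 : 0 <= C by rewrite /C !addr_ge0// mulr_ge0.
(* [del] is both the precision of each step and the initial error; growth by exp C over unit time
   keeps it at most d / 2. *)
pose del := Num.min 1 (d / (2 * expR C)).
have eC : 0 < 2 * expR C by rewrite mulr_gt0// expR_gt0.
have del0 : 0 < del by rewrite lt_min ltr01 divr_gt0.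
have del1 : 0 < del <= 1 by rewrite del0 ge_min lexx.
have deld : del * (2 * expR C) <= d by rewrite -ler_pdivlMr// ge_min lexx orbT.
(* The arbitrary slack [h] makes the statement stable under limits in [s], at which it pays for the
   distance between nearby points of the path. *)
pose G s := forall h, 0 < h -> exists P P1,
  lift_in H P P1 /\ C1_near (del * expR (C * s) + h) P P1 (path s) (path1 s).
have [B phiB] : exists B, forall x, `|F x - x| <= B.
  have phiP : periodic (fun x => F x - x) tau by move=> x; rewrite FP; ring.
  apply: periodic_bound phiP => x; apply: cvgB; last exact: cvg_id.
  exact: is_derive_continuous dF x.
have B0 : 0 <= B := le_trans (normr_ge0 _) (phiB 0).
pose M := B + K + 1.
have M0 : 0 < M by rewrite /M ltr_wpDl// addr_ge0.
have path_near s t : C1_near (`|s - t| * M) (path s) (path1 s) (path t) (path1 t).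
  move=> x; split.
    rewrite (_ : _ - _ = (s - t) * (F x - x)); last by rewrite /path; ring.
    by apply: norm_mulW => //; apply: le_trans (phiB x) _; rewrite /M; lra.
  rewrite (_ : _ - _ = (s - t) * (F1 x - 1)); last by rewrite /path1; ring.
  apply: norm_mulW => //; apply: le_trans (norm_addW (F1K x) (lexx _)) _.
  by rewrite normrN normr1 /M; lra.
have G1 : G 1.
  apply: real_induction.
  - move=> h h0; exists id, (cst 1); split; first exact: lift_in_id.
    move=> x; rewrite /path /path1 /= !mul0r !addr0 !subrr normr0.
    by rewrite addr_ge0 ?mulr_ge0 ?expR_ge0// ltW.
  - move=> t t01 tG h h0.
    have h20 : 0 < h / 2 by rewrite divr_gt0.
    have [s [Gs /andP[s0 st] ts]] := tG _ (divr_gt0 h20 M0).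
    have [P [P1 [Pin PC]]] := Gs _ h20; exists P, P1; split=> //.
    apply: C1_near_le (C1_nearT PC (path_near s t)) _.
    have : `|s - t| * M <= h / 2.
      by rewrite -ler_pdivlMr// ler0_norm ?subr_le0// opprB; lra.
    have : del * expR (C * s) <= del * expR (C * t).
      by rewrite ler_wpM2l ?(ltW del0)// ler_expR ler_wpM2l.
    lra.
  - move=> t /andP[t0 t1] Gt.
    have t01 : 0 <= t <= 1 by rewrite t0 ltW.
    have [v [v1 [vC vP v1P vE v1E]]] := hL t t01.
    have vt := Htan vC vP v1P.
    have [e0 e00 he] := flow_step vC vt del1 k1.
    pose e := Num.min (e0 / 2) (1 - t).
    have e_gt0 : 0 < e by rewrite lt_min divr_gt0// subr_gt0.
    have ee0 : 0 <= e < e0.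
      rewrite (ltW e_gt0)/= (le_lt_trans (_ : _ <= e0 / 2))// ?ge_min ?lexx//.
      lra.
    have te : t + e <= 1 by rewrite -lerBrDl ge_min lexx orbT.
    exists e => //; split=> // h h0.
    have eC0 : 0 < 1 + e * C by rewrite ltr_pwDl// mulr_ge0// ltW.
    (* The slack is divided in advance by the growth factor of the step; the main term is absorbed
       by 1 + e C <= exp (e C). *)
    have [P [P1 [Pin PC]]] := Gt _ (divr_gt0 h0 eC0).
    have path1k x : `|path1 t x| <= k.
      rewrite /path1 (_ : _ + _ = (1 - t) * 1 + t * F1 x); last by ring.
      have a1 : `|1 - t| <= 1 by rewrite ger0_norm; lra.
      have a2 : `|t| <= 1 by rewrite ger0_norm; lra.
      apply: le_trans (norm_addW (norm_mulW a1 (lexx `|1|))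
        (norm_mulW a2 (F1K x))) _.
      by rewrite normr1 /k; lra.
    have delE : del <= del * expR (C * t) + h / (1 + e * C).
      have : del * 1 <= del * expR (C * t).
        by rewrite ler_wpM2l ?(ltW del0)// -expR0 ler_expR mulr_ge0.
      have : 0 <= h / (1 + e * C) by rewrite divr_ge0// ltW.
      lra.
    have [Q [Q1 [Qin QC]]] := he e ee0 _ _ _ _ _ delE Pin PC path1k.
    exists Q, Q1; split=> //.
    rewrite (_ : path (t + e) = fun x => path t x + e * v (path t x)); last first.
      by apply/funext => x; rewrite vE /path; ring.
    rewrite (_ : path1 (t + e) = fun x =>
      path1 t x + e * (v1 (path t x) * path1 t x)); last first.
      by apply/funext => x; rewrite v1E /path1; ring.
    apply: C1_near_le QC _; rewrite -/C mulrDl divfK ?gt_eqF// lerD2r.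
    rewrite -mulrA ler_wpM2l ?(ltW del0)// [C * (t + e)]mulrDr expRD.
    rewrite ler_wpM2l ?expR_ge0//.
    by rewrite [C * e]mulrC expR_ge1Dx.
have [P [P1 [Pin PC]]] := G1 _ (divr_gt0 d0 (ltr0n R 2)).
exists P, P1; split=> // x; have [Pv Pd] := PC x.
have pF : path 1 x = F x by rewrite /path; ring.
have p1F : path1 1 x = F1 x by rewrite /path1; ring.
rewrite pF p1F mulr1 in Pv Pd.
by split; [apply: le_trans Pv _|apply: le_trans Pd _]; lra.
Qed.

End Path.
End PathInduction.

(** * Approximating a C^1 lift by one with Lipschitz derivative *)

Section Smoothing.
Context {R : realType}.

(* [G x] is the mean value of [F] over [x, x + h]. *)
Lemma lift_smoothing (F F1 : R -> R) (e : R) : clift F F1 -> 0 < e ->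
  exists G G1 K, [/\ clift G G1, C1_near e G G1 F F1,
    forall x, `|G1 x| <= K & forall x y, `|G1 x - G1 y| <= K * `|x - y|].
Proof.
move=> FL e0; have [dF cF1 F10 FP] := FL.
have F1P := clift_derive_periodic FL.
have [K F1K] := periodic_bound cF1 F1P.
have K0 : 0 <= K := le_trans (normr_ge0 _) (F1K 0).
have [s s0 hs] := periodic_unif_continuous cF1 F1P e0.
have [A dA] := continuous_primitive (is_derive_continuous dF).
pose h := Num.min (s / 2) (e / (K + 1)).
have K10 : 0 < K + 1 by rewrite ltr_wpDl.
have h0 : 0 < h by rewrite lt_min !divr_gt0.
have hN0 : h != 0 by rewrite gt_eqF.
have h_s : h < s by rewrite (le_lt_trans (_ : _ <= s / 2)) ?ge_min ?lexx//; lra.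
have hK : K * h <= e.
  have : h <= e / (K + 1) by rewrite ge_min lexx orbT.
  rewrite ler_pdivlMr// mulrDr mulr1 mulrC; lra.
have hV0 : 0 <= h^-1 by rewrite invr_ge0 ltW.
pose G (x : R) : R := h^-1 * (A (x + h) - A x).
pose G1 (x : R) : R := h^-1 * (F (x + h) - F x).
pose G2 (x : R) : R := h^-1 * (F1 (x + h) - F1 x).
have dquot (B B1 : R -> R) (x : R) : (forall y : R, is_derive y 1 B (B1 y)) ->
    is_derive x 1 (fun x => h^-1 * (B (x + h) - B x)) (h^-1 * (B1 (x + h) - B1 x)).
  move=> dB.
  have d : is_derive x 1 (h^-1 *: ((fun x => B (x + h)) - B))
      (h^-1 *: (B1 (x + h) - B1 x)).
    by apply: is_deriveZ; apply: is_deriveB; exact: is_derive_translate.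
  exact: d.
have dG (x : R) : is_derive x 1 G (G1 x) by exact: dquot.
have dG1 (x : R) : is_derive x 1 G1 (G2 x) by exact: dquot.
(* By the mean value theorem, [G x] and [G1 x] are values of [F] and [F1] within [h] of [x];
   positivity, bounds and closeness all follow from this. *)
have quotE (B B1 : R -> R) (x : R) : (forall y : R, is_derive y 1 B (B1 y)) ->
    exists2 c, `|c - x| <= h & h^-1 * (B (x + h) - B x) = B1 c.
  move=> dB; have [c] := mean_value x (x + h) dB.
  rewrite addrAC subrr add0r (gtr0_norm h0) => ch ->; exists c => //.
  by rewrite mulrC mulfK.
have GP x : G (x + tau) = G x + tau.
  have dAt (y : R) : is_derive y 1 ((fun x => A (x + tau)) - A) tau.
    have d : is_derive y 1 ((fun x => A (x + tau)) - A) (F (y + tau) - F y).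
      by apply: is_deriveB; exact: is_derive_translate.
    by move: d; rewrite FP addrAC subrr add0r.
  have [c _] := mean_value x (x + h) dAt.
  rewrite !fctE addrAC [x + h - x]addrAC subrr add0r => AE.
  apply: (mulfI hN0); rewrite mulrDr /G !mulVKf//.
  by move: AE; rewrite (addrAC x tau h); lra.
have G1K x : `|G1 x| <= K by rewrite /G1; have [c _ ->] := quotE _ _ x dF.
have KL : 0 <= K / h by rewrite mulr_ge0.
exists G, G1, (K + (h^-1 * (K + K))); split.
- split=> //; first exact: is_derive_continuous dG1.
  by move=> x; rewrite /G1; have [c _ ->] := quotE _ _ x dF.
- move=> x; split.
    rewrite /G; have [c ch ->] := quotE _ _ x dA.
    apply: le_trans (lipschitz_of_derive dF F1K c x) _.
    by apply: le_trans hK; rewrite ler_wpM2l.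
  rewrite /G1; have [c ch ->] := quotE _ _ x dF.
  by apply/ltW/hs; exact: le_lt_trans h_s.
- by move=> x; apply: le_trans (G1K x) _; rewrite lerDl mulr_ge0// addr_ge0.
- have G2K x : `|G2 x| <= h^-1 * (K + K).
    apply: norm_mulW; first by rewrite ger0_norm.
    by apply: norm_addW; rewrite ?normrN.
  move=> x y; apply: le_trans (lipschitz_of_derive dG1 G2K x y) _.
  by rewrite ler_wpM2r// lerDr.
Qed.

Lemma expi_lipschitz (a b : R) :
  `|set_val (expi a) - set_val (expi b)| <= `|a - b|.
Proof.
rewrite !set_valE/= prod_normE/= ge_max.
have := @lipschitz_of_derive R sin cos 1 (@is_derive_sin R) (@cos_max R) a b.
have cN x : `|- sin x| <= 1 :> R by rewrite normrN sin_max.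
have := @lipschitz_of_derive R cos (fun x => - sin x) 1 (@is_derive_cos R) cN a b.
by rewrite mul1r => -> ->.
Qed.

End Smoothing.

(** * Density of the subgroup generated by the rotation and the sine map *)

Section DenseSubgroup.
Context {R : realType}.

Lemma subgroup_generated (G : groupType) (S : set G) :
  subgroup (generated_subgroup S).
Proof.
split=> [|x y]; rewrite !inE /generated_subgroup /smallest.
  by move=> A [[A1 _] _]; have := A1; rewrite inE.
move=> xS yS A [[A1 Adiv] SA].
have := Adiv x y; rewrite !in_setE; apply.
  by apply: xS; split.
by apply: yS; split.
Qed.

Lemma sine_lift : clift (fun x : R => x - 4 / 5 * sin x)
  (fun x => 1 - 4 / 5 * cos x).
Proof.
split.
- move=> x; have d : is_derive x 1 (id - (4 / 5) *: sin) (1 - (4 / 5) *: cos x).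
    by apply: is_deriveB; exact: is_deriveZ.
  exact: d.
- move=> x; apply: cvgB; first exact: cvg_cst.
  by apply: cvgM; [exact: cvg_cst|exact: continuous_cos].
- by move=> x; have := cos_le1 x; lra.
- by move=> x; rewrite sinD2pi; ring.
Qed.

Lemma rotation_lift (s : R) : clift (fun x => x + s) (cst 1).
Proof.
split=> [x||x|x].
- exact: is_derive_translate.
- exact: cst_continuous.
- exact: ltr01.
- by rewrite addrAC.
Qed.

Lemma dense_of_generators (H : set (diff1p R)) : subgroup H ->
  rotation_in H (tau * Num.sqrt 2) ->
  lift_in H (fun x => x - 4 / 5 * sin x) (fun x => 1 - 4 / 5 * cos x) ->
  dense H.
Proof.
move=> Hgrp Hrot Hk; apply/diff1p_denseP => f e e0.
have [F [FL fF]] := diff1p_lift f.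
(* Spent twice, on smoothing the lift of [f] and on approximating the smooth lift; the remaining
   third gives strict inequality. *)
have e30 : 0 < e / 3 by rewrite divr_gt0.
have [G [G1 [K [GL GF G1K G1L]]]] := lift_smoothing FL e30.
have Htan := tangent_periodic Hgrp Hrot
  (fun n n0 => tangent_sin Hgrp Hrot Hk n0).
have [P [P1 [[[dP _ _ _] [g Hg gP]] PG]]] := lift_approx Hgrp Htan GL G1K G1L e30.
have PF t : `|P t - F t| < e /\ `|P1 t - angle_derivative f t| < e.
  have [a b] := C1_nearT PG GF t; split.
    by apply: le_lt_trans a _; lra.
  by apply: le_lt_trans b _; lra.
exists g => //; split.
  move=> p; have [t <-] := expi_surj p; rewrite fF gP.
  by apply: le_lt_trans (expi_lipschitz _ _) _; rewrite distrC; case: (PF t).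
by move=> t; rewrite (angle_derivative_lift gP (dP t)) distrC; case: (PF t).
Qed.

End DenseSubgroup.

Theorem corollary1p4 (R : realType) :
  exists H : set (diff1p R),
    [/\ subgroup H, finitely_generated H & dense H].
Proof.
have [g gE] := diff1p_of_lift (rotation_lift (tau * Num.sqrt 2 : R)).
have [k kE] := diff1p_of_lift (@sine_lift R).
pose S := [set g; k]; exists (generated_subgroup S).
have Hgrp := subgroup_generated S.
have SH : S `<=` generated_subgroup S by exact: sub_gen_smallest.
split=> //; first by exists S; split=> //; exact: finite_set2.
apply: dense_of_generators => //; split.
- exact: rotation_lift.
- by exists g => //; apply: SH; left.
- exact: sine_lift.
- by exists k => //; apply: SH; right.
Qed.
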